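(* Let $\Lambda$ be a finite-dimensional basic algebra over a field, let $\mathcal W\subseteq\mathrm{mod}\,\Lambda$ be a functorially finite wide subcategory, and let $M\in\mathcal W$ be a gen-minimal module which is $\tau$-rigid in $\mathcal W$. Then, in the lattice $\mathrm{tors}(\mathcal W)$, $$\mathrm{pop}_{\uparrow,\mathcal W}(\mathrm{Gen}_{\mathcal W}M)=\{X\in\mathcal W\mid\mathrm{Hom}_\Lambda(X,\tau_{\mathcal W}M)=0\}.$$
   Context: $\mathrm{mod}\,\Lambda$ is the category of finitely generated left modules; subcategories are full and closed under isomorphism. A subcategory is wide if closed under kernels, cokernels and extensions; a wide subcategory is functorially finite if and only if it is equivalent to the category of finitely generated modules over some finite-dimensional algebra. $\tau_{\mathcal W}$ is the Auslander-Reiten translate of $\mathcal W$ (transported along such an equivalence). A basic module $M\in\mathcal W$ is $\tau$-rigid in $\mathcal W$ if $\mathrm{Hom}_\Lambda(M,\tau_{\mathcal W}M)=0$. $\mathrm{Gen}_{\mathcal W}\mathcal C$ is the class of modules in $\mathcal W$ that are quotients of finite direct sums of modules in $\mathcal C$. A $\tau$-rigid $M=\bigoplus_{i=1}^kM_i$ ($M_i$ indecomposable) is gen-minimal if $M_j\notin\mathrm{Gen}_{\mathcal W}(\bigoplus_{i\ne j}M_i)$ for all $j$. A torsion class of $\mathcal W$ is a subcategory $\mathcal T\subseteq\mathcal W$ closed under extensions with $\mathcal T=\mathrm{Gen}_{\mathcal W}\mathcal T$; $\mathrm{tors}(\mathcal W)$ is the complete lattice of torsion classes of $\mathcal W$ under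 inclusion. For $\mathcal T\in\mathrm{tors}(\mathcal W)$, $\mathrm{pop}_{\uparrow,\mathcal W}(\mathcal T)$ is the join in $\mathrm{tors}(\mathcal W)$ of $\mathcal T$ with all torsion classes covering $\mathcal T$. *)

(* Defs.v *)
From HB Require Import structures.
From mathcomp Require Import all_boot all_algebra.
From mathcomp Require Import boolp.

Set Implicit Arguments.
Unset Strict Implicit.
Unset Printing Implicit Defensive.
Import GRing.Theory.
Local Open Scope ring_scope.

(* Finite-dimensional associative algebras, given by a central structure
   morphism.  MathComp's [algType] and [falgType] exclude the zero algebra,
   which is needed here: it is the algebra whose module category is equivalent
   to the wide subcategory 0. *)
Record fdalg (k : fieldType) := FDAlg {
  fdalg_ring :> pzRingType;
  fdscal : {rmorphism k -> fdalg_ring};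
  fdscal_central : forall a x, fdscal a * x = x * fdscal a;
  fdalg_findim : exists s : seq fdalg_ring, forall x, exists c : nat -> k,
    x = \sum_(i < size s) fdscal (c i) * s`_i
}.

Definition fin_gen (A : pzRingType) (U : lmodType A) : Prop :=
  exists s : seq U, forall x, exists c : nat -> A,
    x = \sum_(i < size s) c i *: s`_i.

Record fgmod (A : pzRingType) := FGMod {
  fgmod_lmod :> lmodType A;
  fgmod_fin_gen : fin_gen fgmod_lmod
}.

Lemma regular_fin_gen (A : pzRingType) : fin_gen (A^o : lmodType A).
Proof.
exists [:: 1] => x; exists (fun=> x).
by rewrite big_ord_recl big_ord0 addr0 /= /GRing.scale /= mulr1.
Qed.

Definition regular_mod (A : pzRingType) : fgmod A := FGMod (@regular_fin_gen A).

(* Full subcategories.  The type [set] of mathcomp.classical is not usable here: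
   its universe is too small for the large type [fgmod A]. *)
Definition subcat (A : pzRingType) := fgmod A -> Prop.

Section Modules.
Variable A : pzRingType.
Implicit Types (K M N P Q S X Y Z : fgmod A) (C D T U V W : subcat A).

Definition subcat_le C D : Prop := forall X, C X -> D X.

Definition subcat_eq C D : Prop := forall X, C X <-> D X.

Definition surj M N (f : {linear M -> N}) : Prop := forall y, exists x, f x = y.

Definition exact M N X (f : {linear M -> N}) (g : {linear N -> X}) : Prop :=
  forall y, g y = 0 <-> exists x, f x = y.

Definition is_kernel M N X (i : {linear M -> N}) (f : {linear N -> X}) : Prop :=
  injective i /\ exact i f.

Definition is_cokernel M N X (p : {linear N -> X}) (f : {linear M -> N}) :
  Prop := exact f p /\ surj p.

Definition short_exact M N X (i : {linear M -> N}) (p : {linear N -> X}) :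
  Prop := [/\ injective i, exact i p & surj p].

Definition iso M N : Prop := exists f : {linear M -> N}, bijective f.

Definition zero_mod M : Prop := forall x : M, x = 0.

Definition hom_zero M N : Prop := forall (f : {linear M -> N}) x, f x = 0.

Definition direct_sum (I : finType) (Y : I -> fgmod A) M : Prop :=
  exists h : forall i, {linear Y i -> M},
    forall x, exists! y : (forall i, Y i), x = \sum_i h i (y i).

Definition indecomposable M : Prop :=
  ~ zero_mod M /\
  forall X Y, direct_sum (fun b : bool => if b then X else Y) M ->
    zero_mod X \/ zero_mod Y.

Definition basic M : Prop :=
  exists (n : nat) (Y : 'I_n -> fgmod A),
    [/\ direct_sum Y M, forall i, indecomposable (Y i)
      & forall i j, i != j -> ~ iso (Y i) (Y j)].

Definition iso_closed C : Prop := forall M N, iso M N -> C M -> C N.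

Definition ext_closed C : Prop :=
  forall M N X (i : {linear M -> N}) (p : {linear N -> X}),
    short_exact i p -> C M -> C X -> C N.

Definition ker_closed C : Prop :=
  forall K M N (i : {linear K -> M}) (f : {linear M -> N}),
    is_kernel i f -> C M -> C N -> C K.

Definition coker_closed C : Prop :=
  forall M N Q (f : {linear M -> N}) (p : {linear N -> Q}),
    is_cokernel p f -> C M -> C N -> C Q.

Definition wide W : Prop :=
  [/\ iso_closed W, ker_closed W, coker_closed W & ext_closed W].

Definition right_approx C Y X (f : {linear Y -> X}) : Prop :=
  C Y /\ forall Z (g : {linear Z -> X}), C Z ->
    exists h : {linear Z -> Y}, g =1 f \o h.

Definition left_approx C X Y (f : {linear X -> Y}) : Prop :=
  C Y /\ forall Z (g : {linear X -> Z}), C Z ->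
    exists h : {linear Y -> Z}, g =1 h \o f.

Definition contravariantly_finite C : Prop :=
  forall X, exists Y (f : {linear Y -> X}), right_approx C f.

Definition covariantly_finite C : Prop :=
  forall X, exists Y (f : {linear X -> Y}), left_approx C f.

Definition functorially_finite C : Prop :=
  contravariantly_finite C /\ covariantly_finite C.

Definition Gen W C : subcat A := fun X =>
  W X /\ exists (n : nat) (Y : 'I_n -> fgmod A) S (p : {linear S -> X}),
     [/\ forall i, C (Y i), direct_sum Y S & surj p].

(* [Gen1 W M] is Gen_W M for a single module M. *)
Definition Gen1 W M : subcat A := Gen W (eq M).

Definition gen_minimal W M : Prop :=
  exists (n : nat) (Y : 'I_n -> fgmod A),
    [/\ direct_sum Y M, forall i, indecomposable (Y i)
      & forall j S, direct_sum (fun i : {i | i != j} => Y (val i)) S ->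
          ~ Gen1 W S (Y j)].

Definition torsion_class W T : Prop :=
  [/\ subcat_le T W, ext_closed T & subcat_eq T (Gen W T)].

Definition covers W T U : Prop :=
  [/\ torsion_class W U, subcat_le T U, ~ subcat_eq T U
    & forall V, torsion_class W V -> subcat_le T V -> subcat_le V U ->
        subcat_eq V T \/ subcat_eq V U].

(* The join in tors(W), as the meet of all upper bounds; see [tors_joinP]. *)
Definition tors_join W (F : subcat A -> Prop) : subcat A := fun X =>
  forall U, torsion_class W U -> (forall T, F T -> subcat_le T U) -> U X.

Definition pop_up W T : subcat A :=
  tors_join W (fun U => U = T \/ covers W T U).

Lemma Gen_sub W C D : subcat_le C D -> subcat_le (Gen W C) (Gen W D).
Proof.
move=> CD X [WX [n [Y [S [p [CY dY sp]]]]]]; split=> //.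
by exists n, Y, S, p; split=> // i; apply: CD.
Qed.

Lemma sub_Gen W C : subcat_le C W -> subcat_le C (Gen W C).
Proof.
move=> CW X CX; split; first exact: CW.
exists 1%N, (fun=> X), X, idfun; split=> //; last by move=> x; exists x.
exists (fun=> idfun) => x; exists (fun=> x); split=> [|y].
  by rewrite big_ord_recl big_ord0 addr0.
rewrite big_ord_recl big_ord0 addr0 /= => ->.
by apply: functional_extensionality_dep => i; rewrite [i]ord1.
Qed.

Lemma torsion_class_self W : wide W -> torsion_class W W.
Proof.
by case=> _ _ _ Wext; split=> // X; split=> [|[]//]; apply: sub_Gen.
Qed.

Lemma tors_joinP W (F : subcat A -> Prop) :
  wide W -> (forall T, F T -> torsion_class W T) ->
  [/\ torsion_class W (tors_join W F),
      forall T, F T -> subcat_le T (tors_join W F)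
    & forall U, torsion_class W U -> (forall T, F T -> subcat_le T U) ->
        subcat_le (tors_join W F) U].
Proof.
move=> wW FW.
have JW : subcat_le (tors_join W F) W.
  by move=> X; apply; [exact: torsion_class_self | move=> T /FW []].
split; [|by move=> T FT X TX U _ FU; apply: (FU T FT)|by move=> U tU FU X; apply].
split=> //.
  move=> M N X i p sip JM JX U tU FU; case: (tU) => _ Uext _.
  by apply: (Uext _ _ _ _ _ sip); [apply: JM | apply: JX].
move=> X; split; first exact: sub_Gen.
move=> GX U tU FU; case: (tU) => _ _ UG; apply/UG.
by apply: (Gen_sub _ GX) => Y; apply.
Qed.

Definition projective P : Prop :=
  forall M N (p : {linear M -> N}) (f : {linear P -> N}),
    surj p -> exists g : {linear P -> M}, f =1 p \o g.

Definition proj_cover P M (p : {linear P -> M}) : Prop :=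
  [/\ projective P, surj p
    & forall X (f : {linear X -> P}), surj (p \o f) -> surj f].

Definition min_proj_pres P1 P0 M (p1 : {linear P1 -> P0})
    (p0 : {linear P0 -> M}) : Prop :=
  proj_cover p0 /\
  exists K (i : {linear K -> P0}) (q : {linear P1 -> K}),
    [/\ is_kernel i p0, proj_cover q & p1 =1 i \o q].

(* [is_star e]: via e, the right A-module Q (a left module over the converse
   ring A^c) is Hom_A(P, A) with (h a)(x) = h(x) a. *)
Definition is_star P (Q : fgmod A^c) (e : Q -> {linear P -> A^o}) : Prop :=
  [/\ forall q r x, e (q + r) x = e q x + e r x,
      forall (a : A) q x, e ((a : A^c) *: q) x = (e q x : A) * a,
      forall q r, e q =1 e r -> q = r
    & forall h : {linear P -> A^o}, exists q, e q =1 h].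

End Modules.

(* The Auslander-Bridger transpose: the cokernel of
   Hom(p1, A) : Hom(P0, A) -> Hom(P1, A). *)
Definition is_transpose (A : pzRingType) (M : fgmod A) (Y : fgmod A^c) : Prop :=
  exists (P1 P0 : fgmod A) (p1 : {linear P1 -> P0}) (p0 : {linear P0 -> M})
         (Q0 Q1 : fgmod A^c) (e0 : Q0 -> {linear P0 -> A^o})
         (e1 : Q1 -> {linear P1 -> A^o}) (t : {linear Q0 -> Q1})
         (c : {linear Q1 -> Y}),
    [/\ min_proj_pres p1 p0, is_star e0, is_star e1,
        forall q, e1 (t q) =1 e0 q \o p1 & is_cokernel c t].

Section Algebras.
Variables (k : fieldType).
Implicit Types A B : fdalg k.

Definition basic_algebra A : Prop := basic (regular_mod A).

Definition klinear A (Y : fgmod A^c) (phi : Y -> k) : Prop :=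
  forall a x y,
    phi ((fdscal A a : A^c) *: x + y) = a * phi x + phi y.

(* Via d, the left module Z is Hom_k(Y, k) with (a phi)(y) = phi(y a). *)
Definition is_dual A (Y : fgmod A^c) (Z : fgmod A) : Prop :=
  exists d : Z -> Y -> k,
    [/\ forall z, klinear (d z),
        forall z w y, d (z + w) y = d z y + d w y,
        forall (a : A) z y, d (a *: z) y = d z ((a : A^c) *: y),
        forall z w, d z =1 d w -> z = w
      & forall phi, klinear phi -> exists z, d z =1 phi].

Definition is_tau A (M T : fgmod A) : Prop :=
  exists Y : fgmod A^c, is_transpose M Y /\ is_dual Y T.

Record equivalence A B (W : subcat B) := Equivalence {
  eqv_ob :> fgmod A -> fgmod B;
  eqv_hom : forall M N : fgmod A, {linear M -> N} -> {linear eqv_ob M -> eqv_ob N};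
  eqv_id : forall M : fgmod A, @eqv_hom M M idfun =1 idfun;
  eqv_comp : forall (M N X : fgmod A) (f : {linear M -> N}) (g : {linear N -> X}),
    eqv_hom (g \o f) =1 eqv_hom g \o eqv_hom f;
  eqv_klinear : forall (M N : fgmod A) (a : k) (f g h : {linear M -> N}),
    (forall x, h x = fdscal A a *: f x + g x) ->
    forall y, eqv_hom h y = fdscal B a *: eqv_hom f y + eqv_hom g y;
  eqv_full : forall (M N : fgmod A) (h : {linear eqv_ob M -> eqv_ob N}),
    exists f : {linear M -> N}, eqv_hom f =1 h;
  eqv_faithful : forall (M N : fgmod A) (f g : {linear M -> N}),
    eqv_hom f =1 eqv_hom g -> f =1 g;
  eqv_in : forall M : fgmod A, W (eqv_ob M);
  eqv_ess_surj : forall X : fgmod B, W X -> exists M : fgmod A, iso (eqv_ob M) X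
}.

(* T is (isomorphic to) tau_W M: the Auslander-Reiten translate transported
   along an equivalence between W and the finitely generated modules over a
   finite-dimensional algebra. *)
Definition is_tau_in B (W : subcat B) (M T : fgmod B) : Prop :=
  exists (A : fdalg k) (F : equivalence A W) (N S : fgmod A),
    [/\ iso (F N) M, is_tau N S & iso (F S) T].

End Algebras.

(* Main.v *)
(* Let T = Gen M and let ^perp(tau M) be the class of X with Hom(X, tau M) = 0.
   For a minimal presentation P1 -> P0 -> M -> 0 in W, Hom(X, tau M) is dual to
   the cokernel of Hom(P0, X) -> Hom(P1, X), so X lies in ^perp(tau M) iff every
   map P1 -> X factors through P0; all homological facts are read off from this.

   A cover U of T lies in ^perp(tau M): choose B in U \ T of minimal dimension.
   Then Hom(T, B) = 0, every nonzero map from an object of U to B is surjective,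
   and a nonsplit extension E of an object of T by B lies in T.  By
   gen-minimality every epimorphism E -> M_j with E in T splits, so
   Ext^1(M, B) = 0.  As all proper quotients of B lie in T and the presentation
   is minimal, Hom(B, tau M) = 0, and U is the join of T and B.

   Conversely, if a torsion class G contains T and its covers but not
   ^perp(tau M), choose B in ^perp(tau M) \ G of minimal dimension.  The join of
   T and B is a cover of T, whence B lies in G: if V lies strictly above T and
   below the join, an object N of minimal dimension in V \ T receives a nonzero
   map from B, which is onto since Ext^1(M, -) vanishes on ^perp(tau M), and
   injective since its kernel is again in ^perp(tau M); so B lies in V. *)
Require Import Defs.
From HB Require Import structures.
From mathcomp Require Import all_boot all_algebra.
From mathcomp Require Import boolp.
Local Open Scope ring_scope.

Set Implicit Arguments.
Unset Strict Implicit.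
Unset Printing Implicit Defensive.
Import GRing.Theory.

(** * Submodules and quotients *)

Section LinearMaps.
Variable A : pzRingType.
Implicit Types (U V Z : lmodType A).

(** Turns a function given by choice or by a formula into a bundled map, characterized up to
    [=1]. *)
Lemma linear_pack U V (f : U -> V) :
  linear f -> exists g : {linear U -> V}, g =1 f.
Proof.
move=> lf; pose m := GRing.isLinear.Build A U V *:%R f lf.
pose g : {linear U -> V} := HB.pack f m.
by exists g.
Qed.

Lemma linear_lift U V Z (i : {linear U -> V}) (f : {linear Z -> V}) :
  injective i -> (forall z, exists y, i y = f z) ->
  exists g : {linear Z -> U}, forall z, i (g z) = f z.
Proof.
move=> ii /choice[g ig].
have lg : linear g by move=> a x y; apply: ii; rewrite linearP !ig linearP.
by have [h hg] := linear_pack lg; exists h => z; rewrite hg.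
Qed.

Lemma linear_desc U V Z (p : {linear U -> V}) (f : {linear U -> Z}) :
  (forall y, exists x, p x = y) -> (forall x, p x = 0 -> f x = 0) ->
  exists g : {linear V -> Z}, forall x, g (p x) = f x.
Proof.
move=> /choice[s ps] pf.
have E x : f (s (p x)) = f x.
  by apply/eqP; rewrite -subr_eq0 -linearB pf // linearB ps subrr.
have lg : linear (f \o s).
  move=> a x y /=; rewrite -linearP; apply/eqP; rewrite -subr_eq0 -linearB pf //.
  by rewrite linearB linearP !ps subrr.
by have [h hg] := linear_pack lg; exists h => z; rewrite hg /= E.
Qed.

Definition submod U (P : U -> Prop) :=
  P 0 /\ forall (a : A) x y, P x -> P y -> P (a *: x + y).

Section Submod.
Variables (U : lmodType A) (P : U -> Prop) (sP : submod P).

Lemma submod0 : P 0. Proof. by case: sP. Qed.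
Lemma submodD x y : P x -> P y -> P (x + y).
Proof. by case: sP => _ h Px Py; rewrite -[x]scale1r; apply: h. Qed.
Lemma submodZ a x : P x -> P (a *: x).
Proof. by case: sP => h0 h Px; rewrite -[_ *: _]addr0; apply: h. Qed.
Lemma submodN x : P x -> P (- x).
Proof. by move=> Px; rewrite -scaleN1r; apply: submodZ. Qed.
Lemma submodB x y : P x -> P y -> P (x - y).
Proof. by move=> Px Py; apply: submodD => //; apply: submodN. Qed.
Lemma submod_sum (I : Type) (r : seq I) (F : I -> U) :
  (forall i, P (F i)) -> P (\sum_(i <- r) F i).
Proof.
by move=> h; elim/big_ind: _ => //; [exact: submod0 | exact: submodD].
Qed.

Definition sub_pred : pred U := fun x => `[< P x >].

Lemma sub_pred_closed : submod_closed sub_pred.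
Proof.
split; first by apply/asboolP/submod0.
by move=> a x y /asboolP Px /asboolP Py; apply/asboolP; case: sP => _; apply.
Qed.

Lemma submod_obj : exists (K : lmodType A) (i : {linear K -> U}),
  injective i /\ forall x, P x <-> exists y, i y = x.
Proof.
pose m := GRing.isSubmodClosed.Build A U sub_pred sub_pred_closed.
pose S : submodClosed U := HB.pack sub_pred m.
pose K := {x : U | x \in S}.
pose K1 := GRing.SubChoice_isSubLmodule.Build A U (mem S) K sub_pred_closed.
pose K2 : lmodType A := HB.pack K K1.
pose v : K2 -> U := val.
have lv : linear v by [].
have [i iv] := linear_pack lv.
exists K2, i; split.
  by move=> x y; rewrite !iv; apply: val_inj.
move=> x; split=> [Px|[y <-]].
  have xS : x \in S by apply/asboolP.
  by exists (exist _ x xS); rewrite iv.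
by rewrite iv; apply/asboolP; apply: (valP y).
Qed.

Lemma quot_obj : exists (Q : lmodType A) (p : {linear U -> Q}),
  (forall y, exists x, p x = y) /\ forall x, P x <-> p x = 0.
Proof.
(* [r] picks one representative per coset, since [choose] returns the same value on two elements of
   a coset. The fixed points of [r] then carry the quotient. *)
have [r [rP rE]] : exists r : U -> U,
    (forall x, P (x - r x)) /\ forall x y, P (x - y) -> r x = r y.
  exists (fun x => choose (fun y => `[< P (x - y) >]) x); split=> [x|x y Pxy].
    by apply/asboolP; apply: (@chooseP _ (fun y => `[< P (x - y) >])); apply/asboolP;
      rewrite subrr; apply: submod0.
  have -> : (fun z => `[< P (x - z) >]) = (fun z => `[< P (y - z) >]).
    apply/funext => z; apply/asbool_equiv_eq; split=> h.
      have -> : y - z = (x - z) - (x - y)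
        by rewrite opprB [RHS]addrC addrA subrK.
      exact: submodB.
    have -> : x - z = (y - z) + (x - y)
      by rewrite [RHS]addrC addrA subrK.
    exact: submodD.
  apply: choose_id; apply/asboolP; last by rewrite subrr; exact: submod0.
  by rewrite -opprB; exact: submodN.
have rr x : r (r x) = r x.
  by apply/esym/rE.
pose Q := {x : U | r x == x}.
pose pi (x : U) : Q := exist _ (r x) (introT eqP (rr x)).
have piE x y : P (x - y) -> pi x = pi y by move=> h; apply: val_inj => /=; exact: rE.
have piK (q : Q) : pi (val q) = q.
  by apply: val_inj; rewrite /=; apply/eqP; apply: (valP q).
have valpi x : P (x - val (pi x)) by apply: rP.
have valpi' x : P (val (pi x) - x) by rewrite -opprB; apply: submodN.
pose add (q1 q2 : Q) : Q := pi (val q1 + val q2).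
pose opp (q : Q) : Q := pi (- val q).
pose sc (a : A) (q : Q) : Q := pi (a *: val q).
have addpi x y : add (pi x) (pi y) = pi (x + y).
  by apply: piE; rewrite opprD addrACA; apply: submodD.
have opppi x : opp (pi x) = pi (- x).
  by apply: piE; rewrite -opprD; apply: submodN.
have scpi a x : sc a (pi x) = pi (a *: x).
  by apply: piE; rewrite -scalerBr; apply: submodZ.
have ind (R : Q -> Prop) : (forall x, R (pi x)) -> forall q, R q.
  by move=> h q; rewrite -[q]piK.
have addA : associative add.
  by move=> q1 q2 q3; elim/ind: q1 => x; elim/ind: q2 => y; elim/ind: q3 => z;
    rewrite !addpi addrA.
have addC : commutative add.
  by move=> q1 q2; elim/ind: q1 => x; elim/ind: q2 => y; rewrite !addpi addrC.
have add0 : left_id (pi 0) add by elim/ind => x; rewrite addpi add0r.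
have addN : left_inverse (pi 0) opp add.
  by elim/ind => x; rewrite opppi addpi addNr.
pose m1 := GRing.isZmodule.Build Q addA addC add0 addN.
pose Q1 : zmodType := HB.pack Q m1.
have scA a b (q : Q1) : sc a (sc b q) = sc (a * b) q.
  by elim/ind: q => x; rewrite !scpi scalerA.
have sc1 : left_id 1 (sc : A -> Q1 -> Q1).
  by move=> q; elim/ind: q => x; rewrite scpi scale1r.
have scDr : right_distributive (sc : A -> Q1 -> Q1) +%R.
  move=> a q1 q2; elim/ind: q1 => x; elim/ind: q2 => y.
  by rewrite /GRing.add /= !(addpi, scpi) scalerDr.
have scDl (q : Q1) : {morph (sc ^~ q : A -> Q1) : a b / a + b}.
  move=> a b; elim/ind: q => x.
  by rewrite {2}/GRing.add /= !(addpi, scpi) scalerDl.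
pose m2 := GRing.Zmodule_isLmodule.Build A Q1 scA sc1 scDr scDl.
pose Q2 : lmodType A := HB.pack Q1 m2.
have lpi : linear (pi : U -> Q2).
  move=> a x y; rewrite /GRing.scale /GRing.add /=.
  by rewrite scpi addpi.
have [p pE] := linear_pack lpi.
exists Q2, p; split=> [y|x].
  by exists (val y); rewrite pE piK.
rewrite pE; split=> [Px|h]; first by apply: piE; rewrite subr0.
have : P (x - val (pi x)) by [].
rewrite h => Px; rewrite -[x](subrK (val (pi 0))).
by apply: submodD => //; rewrite -[val _]subr0; apply: valpi'.
Qed.

End Submod.
End LinearMaps.

(** * Dimension *)

Section Dimension.
Variables (k : fieldType) (A : fdalg k).
Implicit Types (V U : lmodType A) (M N X Y Z : fgmod A).

Definition kcomb V (s : seq V) (c : nat -> k) : V :=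
  \sum_(i < size s) fdscal A (c i) *: s`_i.

Definition kspan V (s : seq V) (x : V) : Prop := exists c, x = kcomb s c.

Definition kfree V (s : seq V) : Prop :=
  forall c, kcomb s c = 0 -> forall i, (i < size s)%N -> c i = 0.

Lemma fdscalZ V a (b : A) (x : V) :
  fdscal A a *: (b *: x) = b *: (fdscal A a *: x).
Proof. by rewrite !scalerA fdscal_central. Qed.

Lemma kcombD V (s : seq V) a c d :
  kcomb s (fun i => a * c i + d i) = fdscal A a *: kcomb s c + kcomb s d.
Proof.
rewrite /kcomb scaler_sumr -big_split; apply: eq_bigr => i _ /=.
by rewrite rmorphD rmorphM scalerDl scalerA.
Qed.

Lemma kspan0 V (s : seq V) : kspan s 0.
Proof.
by exists (fun=> 0); rewrite /kcomb big1 // => i _; rewrite rmorph0 scale0r.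
Qed.

Lemma kspanZD V (s : seq V) a x y :
  kspan s x -> kspan s y -> kspan s (fdscal A a *: x + y).
Proof. by move=> [c ->] [d ->]; eexists; rewrite -kcombD. Qed.

Lemma kspanD V (s : seq V) x y : kspan s x -> kspan s y -> kspan s (x + y).
Proof.
by move=> sx sy; rewrite -[x]scale1r -(rmorph1 (fdscal A)); apply: kspanZD.
Qed.

Lemma kspanZ V (s : seq V) a x : kspan s x -> kspan s (fdscal A a *: x).
Proof. by move=> sx; rewrite -[_ *: _]addr0; apply: kspanZD => //; apply: kspan0. Qed.

Lemma kspan_sum V (s : seq V) (I : Type) (r : seq I) (F : I -> V) :
  (forall i, kspan s (F i)) -> kspan s (\sum_(i <- r) F i).
Proof.
by move=> h; elim/big_ind: _ => //; [exact: kspan0 | exact: kspanD].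
Qed.

Lemma kspan_mem V (s : seq V) x : x \in s -> kspan s x.
Proof.
move=> xs; exists (fun i => (i == index x s)%:R).
rewrite /kcomb; have lt : (index x s < size s)%N by rewrite index_mem.
rewrite (bigD1 (Ordinal lt)) //= eqxx rmorph1 scale1r nth_index // big1 ?addr0 //.
by move=> i ni; rewrite -val_eqE /= in ni; rewrite (negPf ni) rmorph0 scale0r.
Qed.

Lemma kcomb_cons V (y : V) s c :
  kcomb (y :: s) c = fdscal A (c 0%N) *: y + kcomb s (c \o S).
Proof. by rewrite /kcomb /= big_ord_recl. Qed.

Lemma kfree_nil V : kfree ([::] : seq V).
Proof. by []. Qed.

Lemma kfree_cons V (y : V) s : kfree s -> ~ kspan s y -> kfree (y :: s).
Proof.
move=> fs ny c; rewrite kcomb_cons => h.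
have c0 : c 0%N = 0.
  apply: contrapT => /eqP c0; apply: ny.
  have -> : y = fdscal A (- (c 0%N)^-1) *: kcomb s (c \o S).
    have -> : kcomb s (c \o S) = - (fdscal A (c 0%N) *: y).
      by apply/eqP; rewrite -addr_eq0 addrC h.
    by rewrite rmorphN scaleNr scalerN opprK scalerA -rmorphM mulVf // rmorph1 scale1r.
  by apply: kspanZ; exists (c \o S).
move: h; rewrite c0 rmorph0 scale0r add0r => h.
by case=> [|i] //; rewrite ltnS; apply: (fs (c \o S) h).
Qed.

Lemma kfree_size V (s t : seq V) :
  (forall x, kspan s x) -> kfree t -> (size t <= size s)%N.
Proof.
move=> ss ft; rewrite leqNgt; apply/negP => lt.
have /choice[c hc] : forall i : 'I_(size t), exists c, t`_i = kcomb s c.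
  by move=> i; apply: ss.
pose C := \matrix_(i < size t, j < size s) c i j.
(* [C] has more rows than columns, so some nonzero row vector [u] kills it; [u] is a relation among
   the entries of [t]. *)
have : kermx C != 0.
  apply/negP => /eqP /(congr1 mxrank); rewrite mxrank_ker mxrank0.
  by move/eqP; rewrite subn_eq0 => h; move: (leq_trans h (rank_leq_col C)); rewrite leqNgt lt.
case/rowV0Pn => u /sub_kermxP uC u0.
case/eqP: u0; apply/rowP => i; rewrite mxE.
(* Coefficients are indexed by natural numbers, so [u] is extended by 0. *)
pose d j := if insub j is Some j' then u 0 (j' : 'I_(size t)) else 0.
have du (j : 'I_(size t)) : d j = u 0 j by rewrite /d valK.
rewrite -du; apply: ft => //; rewrite /kcomb.
under eq_bigr => j _ do rewrite du hc /kcomb scaler_sumr.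
rewrite exchange_big big1 // => j _ /=.
under eq_bigr => l _ do rewrite scalerA -rmorphM.
rewrite -scaler_suml -rmorph_sum.
have /rowP /(_ j) := uC; rewrite !mxE => h.
by under eq_bigr => l _ do [rewrite (_ : c l j = C l j); last by rewrite mxE]; rewrite h rmorph0 scale0r.
Qed.

Lemma fg_kspan M : exists s : seq M, forall x, kspan s x.
Proof.
have [r rP] := fdalg_findim A; have [s sP] := fgmod_fin_gen M.
exists [seq a *: m | a <- r, m <- s] => x.
have [c ->] := sP x; apply: kspan_sum => i.
have [d ->] := rP (c i); rewrite scaler_suml; apply: kspan_sum => j.
rewrite -scalerA; apply: kspanZ; apply: kspan_mem.
by apply: allpairs_f; apply: mem_nth.
Qed.

Lemma dim_exists M : exists n, (exists t : seq M, kfree t /\ size t = n) /\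
  forall t : seq M, kfree t -> (size t <= n)%N.
Proof.
have [s sP] := fg_kspan M.
pose P n := `[< exists t : seq M, kfree t /\ size t = n >].
have exP : exists n, P n by exists 0%N; apply/asboolP; exists [::]; split=> //; apply: kfree_nil.
have bP n : P n -> (n <= size s)%N.
  by move=> /asboolP[t [ft <-]]; apply: kfree_size.
case: (ex_maxnP exP bP) => n /asboolP Pn maxn; exists n; split=> // t ft.
by apply: maxn; apply/asboolP; exists t.
Qed.

(** Taken as the maximal size of a free sequence: strict decrease along proper submodules and
    quotients then follows by adjoining one vector. *)
Definition dim M : nat := projT1 (cid (dim_exists M)).

Lemma dim_free M : exists t : seq M, kfree t /\ size t = dim M.
Proof. by rewrite /dim; case: cid => n /= []. Qed.

Lemma dim_max M (t : seq M) : kfree t -> (size t <= dim M)%N.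
Proof. by rewrite /dim; case: cid => n /= [_]; apply. Qed.

Lemma kcomb_map V U (f : {linear V -> U}) (s : seq V) c :
  kcomb (map f s) c = f (kcomb s c).
Proof.
rewrite /kcomb linear_sum size_map; apply: eq_bigr => i _.
by rewrite (nth_map 0) // linearZ.
Qed.

Lemma kfree_map_inj V U (f : {linear V -> U}) (s : seq V) :
  injective f -> kfree s -> kfree (map f s).
Proof.
move=> fi fs c; rewrite kcomb_map size_map => h; apply: fs.
by apply: fi; rewrite h linear0.
Qed.

Lemma kfree_of_map V U (f : {linear V -> U}) (s : seq V) :
  kfree (map f s) -> kfree s.
Proof.
by move=> fs c h i si; apply: fs; rewrite ?size_map // kcomb_map h linear0.
Qed.

Lemma dim_inj_lt M N (f : {linear M -> N}) y :
  injective f -> (forall x, f x <> y) -> (dim M < dim N)%N.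
Proof.
move=> fi ny; have [t [ft <-]] := dim_free M.
rewrite -(size_map f); apply: (@dim_max N (y :: map f t)).
apply: kfree_cons; first exact: kfree_map_inj.
by case=> c; rewrite kcomb_map => /esym/ny.
Qed.

(** A maximal free sequence of [N] is lifted along a section of [p] and [x] is adjoined; applying
    [p] shows that [x] is outside the span of the lifts. *)
Lemma dim_surj_lt M N (p : {linear M -> N}) x :
  surj p -> p x = 0 -> x <> 0 -> (dim N < dim M)%N.
Proof.
move=> /choice[s ps] px x0; have [t [ft <-]] := dim_free N.
have E : map p (map s t) = t by rewrite -map_comp map_id_in // => y _ /=.
have fst : kfree (map s t) by apply: (@kfree_of_map _ _ p); rewrite E.
rewrite -(size_map s); apply: (@dim_max M (x :: map s t)).
apply: kfree_cons => // -[c xE].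
have c0 i : (i < size t)%N -> c i = 0.
  by apply: ft; rewrite -E kcomb_map -xE px.
apply: x0; rewrite xE /kcomb big1 // => i _; rewrite c0 ?rmorph0 ?scale0r //.
by rewrite -(size_map s).
Qed.

Lemma surj_of_inj M (e : {linear M -> M}) : injective e -> surj e.
Proof.
move=> ei y; apply: contrapT => /forallNP ny.
by have := dim_inj_lt ei ny; rewrite ltnn.
Qed.

Lemma linear_inj V U (f : {linear V -> U}) :
  (forall x, f x = 0 -> x = 0) -> injective f.
Proof.
move=> h x y fxy; apply/eqP; rewrite -subr_eq0; apply/eqP; apply: h.
by rewrite linearB fxy subrr.
Qed.

Lemma inj_of_surj M N (e : {linear M -> N}) :
  surj e -> (dim M <= dim N)%N -> injective e.
Proof.
move=> es le; apply: linear_inj => x ex0; apply: contrapT => x0.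
by have := dim_surj_lt es ex0 x0; rewrite ltnNge le.
Qed.

Lemma bij_of_inj_surj M N (f : {linear M -> N}) :
  injective f -> surj f -> bijective f.
Proof.
move=> fi /choice[g fg]; exists g => // x.
by apply: fi; rewrite fg.
Qed.

Lemma linear_inv M N (f : {linear M -> N}) :
  injective f -> surj f ->
  exists g : {linear N -> M}, cancel f g /\ cancel g f.
Proof.
move=> fi fs; have [g hg] := @linear_lift A M N N f idfun fi fs.
by exists g; split=> // x; apply: fi; rewrite hg.
Qed.

Lemma bijE M N (f : {linear M -> N}) :
  bijective f <-> injective f /\ surj f.
Proof.
split=> [b|[]]; last exact: bij_of_inj_surj.
split; first exact: bij_inj.
by case: b => g _ gf y; exists (g y).
Qed.

(** Free sequences in the submodule have size at most [dim M], and one of maximal size spans it over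
    k, hence over [A]. *)
Lemma sub_fg M (P : M -> Prop) : submod P ->
  exists (K : fgmod A) (i : {linear K -> M}),
    injective i /\ forall x, P x <-> exists y, i y = x.
Proof.
move=> sP; have [K [i [ii iP]]] := submod_obj sP.
suff fK : fin_gen K by exists (FGMod fK), i.
pose Q n := `[< exists t : seq K, kfree t /\ size t = n >].
have exQ : exists n, Q n by exists 0%N; apply/asboolP; exists [::]; split=> //; apply: kfree_nil.
have bQ n : Q n -> (n <= dim M)%N.
  by move=> /asboolP[t [ft <-]]; rewrite -(size_map i); apply/dim_max/kfree_map_inj.
case: (ex_maxnP exQ bQ) => n /asboolP[t [ft tn]] maxn; exists t => x.
have : kspan t x.
  apply: contrapT => nx; have := maxn (size (x :: t)).
  rewrite /= tn ltnn => h; suff : false by []; apply: h.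
  by apply/asboolP; exists (x :: t); rewrite /= tn; split=> //; apply: kfree_cons.
by case=> c ->; exists (fun i => fdscal A (c i)).
Qed.

Lemma fin_gen_surj (R : pzRingType) (V U : lmodType R) (p : {linear V -> U}) :
  (forall y, exists x, p x = y) -> fin_gen V -> fin_gen U.
Proof.
move=> ps [s sP]; exists (map p s) => y; have [x <-] := ps y.
have [c ->] := sP x; exists c; rewrite linear_sum size_map.
by apply: eq_bigr => i _; rewrite linearZ (nth_map 0).
Qed.

Lemma quot_fg M (P : M -> Prop) : submod P ->
  exists (Q : fgmod A) (p : {linear M -> Q}),
    surj p /\ forall x, P x <-> p x = 0.
Proof.
move=> sP; have [Q [p [ps pP]]] := quot_obj sP.
by exists (FGMod (fin_gen_surj ps (fgmod_fin_gen M))), p.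
Qed.

Lemma submod_ker V U (f : {linear V -> U}) : submod (fun x => f x = 0).
Proof.
by split=> [|a x y fx fy]; rewrite ?linear0 // linearP fx fy scaler0 addr0.
Qed.

Lemma submod_im V U (f : {linear V -> U}) : submod (fun y => exists x, f x = y).
Proof.
split=> [|a _ _ [x <-] [y <-]]; first by exists 0; rewrite linear0.
by exists (a *: x + y); rewrite linearP.
Qed.

Lemma submod_preim V U (f : {linear V -> U}) P :
  submod P -> submod (fun x => P (f x)).
Proof.
move=> [P0 sP]; split=> [|a x y Px Py]; first by rewrite linear0.
by rewrite linearP; apply: sP.
Qed.

Lemma ker_fg M N (f : {linear M -> N}) :
  exists (K : fgmod A) (i : {linear K -> M}), is_kernel i f.
Proof.
by have [K [i [ii iP]]] := sub_fg (submod_ker f); exists K, i.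
Qed.

Lemma coker_fg M N (f : {linear M -> N}) :
  exists (Q : fgmod A) (p : {linear N -> Q}), is_cokernel p f.
Proof.
have [Q [p [ps pP]]] := quot_fg (submod_im f); exists Q, p; split=> // y.
by rewrite -pP.
Qed.

Lemma im_fg M N (f : {linear M -> N}) :
  exists (I : fgmod A) (q : {linear M -> I}) (j : {linear I -> N}),
    [/\ surj q, injective j & forall x, f x = j (q x)].
Proof.
have [I [j [ij jP]]] := sub_fg (submod_im f).
have [q hq] : exists q : {linear M -> I}, forall z, j (q z) = f z.
  by apply: linear_lift => // z; apply/jP; exists z.
exists I, q, j; split=> // y; have [x xy] : exists x, f x = j y by apply/jP; exists y.
by exists x; apply: ij; rewrite hq.
Qed.

Lemma ffun_fin_gen (n : nat) M : fin_gen {ffun 'I_n -> M}.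
Proof.
have [s sP] := fgmod_fin_gen M.
pose e (i : 'I_n) (x : M) : {ffun 'I_n -> M} := [ffun j => if j == i then x else 0].
pose L := [seq e i x | i <- enum 'I_n, x <- s].
pose P (x : {ffun 'I_n -> M}) := exists c : nat -> A, x = \sum_(i < size L) c i *: L`_i.
have PZD a x y : P x -> P y -> P (a *: x + y).
  move=> [c ->] [d ->]; exists (fun i => a * c i + d i).
  rewrite scaler_sumr -big_split; apply: eq_bigr => i _ /=.
  by rewrite scalerDl scalerA.
have P0 : P 0 by exists (fun=> 0); rewrite big1 // => i _; rewrite scale0r.
have sP' : submod P by [].
have PL x : x \in L -> P x.
  move=> xs; exists (fun i => (i == index x L)%:R).
  have lt : (index x L < size L)%N by rewrite index_mem.
  rewrite (bigD1 (Ordinal lt)) //= eqxx scale1r nth_index // big1 ?addr0 //.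
  by move=> i ni; rewrite -val_eqE /= in ni; rewrite (negPf ni) scale0r.
exists L => x; change (P x).
have -> : x = \sum_i e i (x i).
  apply/ffunP => j; rewrite sum_ffunE (bigD1 j) //= ffunE eqxx big1 ?addr0 //.
  by move=> i ni; rewrite ffunE eq_sym (negPf ni).
apply: submod_sum => // i; have [c ->] := sP (x i).
have -> : e i (\sum_(j < size s) c j *: s`_j) = \sum_(j < size s) c j *: e i s`_j.
  apply/ffunP => l; rewrite sum_ffunE ffunE; case: eqP => li.
    by apply: eq_bigr => j _; rewrite !ffunE li eqxx.
  by rewrite big1 // => j _; rewrite !ffunE; case: eqP => // _; rewrite scaler0.
apply: submod_sum => // j; apply: submodZ => //; apply: PL.
by apply: allpairs_f; rewrite ?mem_enum // mem_nth.
Qed.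

Definition powmod M n : fgmod A := FGMod (ffun_fin_gen n M).

Lemma pair_fin_gen M N : fin_gen (M * N)%type.
Proof.
have [s sP] := fgmod_fin_gen M; have [t tP] := fgmod_fin_gen N.
exists ([seq (x, 0) | x <- s] ++ [seq (0, y) | y <- t]) => -[x y].
have [c ->] := sP x; have [d ->] := tP y.
exists (fun i => if (i < size s)%N then c i else d (i - size s)%N).
rewrite size_cat !size_map big_split_ord /=.
transitivity ((\sum_(i < size s) c i *: (s`_i, 0 : N)) +
              (\sum_(i < size t) d i *: (0 : M, t`_i))).
  rewrite [RHS]surjective_pairing; congr (_, _).
    rewrite raddfD /= !raddf_sum /= [X in _ + X]big1 ?addr0 // => i _ /=.
    by rewrite scaler0.
  rewrite raddfD /= !raddf_sum /= [X in X + _]big1 ?add0r // => i _ /=.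
  by rewrite scaler0.
congr (_ + _); apply: eq_bigr => i _.
  by rewrite nth_cat size_map ltn_ord (nth_map 0).
by rewrite nth_cat size_map ltnNge leq_addr /= addKn (nth_map 0).
Qed.

Definition prodmod M N : fgmod A := FGMod (pair_fin_gen M N).

Lemma min_dim (C : fgmod A -> Prop) : (exists X, C X) ->
  exists X, C X /\ forall Y, C Y -> (dim X <= dim Y)%N.
Proof.
move=> [X CX]; pose P n := `[< exists Y, C Y /\ dim Y = n >].
have exP : exists n, P n by exists (dim X); apply/asboolP; exists X.
case: (ex_minnP exP) => n /asboolP[Y [CY <-]] minn; exists Y; split=> // Z CZ.
by apply: minn; apply/asboolP; exists Z.
Qed.

End Dimension.

(** * Vanishing of Hom(X, tau M) in a module category *)

Section HomTau.
Variables (k : fieldType) (A : fdalg k).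
Implicit Types (M N X P : fgmod A).

(** Builds a complement of the line k v by running through [s]: an entry that is already in Z + k v
    is skipped, any other is added to [Z], which still avoids [v]. *)
Lemma sep_hyperplane (V : lmodType A) (s : seq V) (v : V) (Z : V -> Prop) :
  Z 0 -> (forall a x y, Z x -> Z y -> Z (fdscal A a *: x + y)) -> ~ Z v ->
  exists Z' : V -> Prop,
    [/\ forall x, Z x -> Z' x,
        Z' 0 /\ forall a x y, Z' x -> Z' y -> Z' (fdscal A a *: x + y),
        ~ Z' v & forall y, y \in s -> exists a, Z' (y - fdscal A a *: v)].
Proof.
elim: s Z => [|y s IH] Z Z0 ZD Zv; first by exists Z; split.
have [[a Za]|ny] := pselect (exists a, Z (y - fdscal A a *: v)).
  have [Z' [ZZ' ZD' Zv' sZ']] := IH Z Z0 ZD Zv; exists Z'; split=> // x.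
  by rewrite inE => /orP[/eqP ->|/sZ' //]; exists a; apply: ZZ'.
pose Y x := exists a z, Z z /\ x = fdscal A a *: y + z.
have YZ x : Z x -> Y x by exists 0, x; rewrite rmorph0 scale0r add0r.
have Y0 : Y 0 by apply: YZ.
have YD a x x' : Y x -> Y x' -> Y (fdscal A a *: x + x').
  move=> [b [z [Zz ->]]] [b' [z' [Zz' ->]]].
  exists (a * b + b'), (fdscal A a *: z + z'); split; first exact: ZD.
  by rewrite scalerDr scalerA -rmorphM addrACA -scalerDl -rmorphD.
have Yv : ~ Y v.
  move=> [a [z [Zz vE]]]; have [a0|a0] := eqVneq a 0.
    by apply: Zv; rewrite vE a0 rmorph0 scale0r add0r.
  apply: ny; exists a^-1; rewrite vE scalerDr scalerA -rmorphM mulVf // rmorph1.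
  rewrite scale1r opprD addrA subrr add0r -scaleNr -rmorphN -[_ *: z]addr0.
  exact: ZD.
have [Z' [ZZ' ZD' Zv' sZ']] := IH Y Y0 YD Yv; exists Z'; split=> //.
  by move=> x Zx; apply/ZZ'/YZ.
move=> x; rewrite inE => /orP[/eqP ->|/sZ' //]; exists 0.
rewrite rmorph0 scale0r subr0; apply: ZZ'; exists 1, 0; split=> //.
by rewrite rmorph1 scale1r addr0.
Qed.

(** The value at x is the unique scalar a such that x - a v lies in the hyperplane given by
    [sep_hyperplane]. *)
Lemma sep_functional X (Z : X -> Prop) (v : X) :
  Z 0 -> (forall a x y, Z x -> Z y -> Z (fdscal A a *: x + y)) -> ~ Z v ->
  exists l : X -> k,
    [/\ forall a x y, l (fdscal A a *: x + y) = a * l x + l y,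
        forall x, Z x -> l x = 0 & l v = 1].
Proof.
move=> Z0 ZD Zv; have [s sP] := fg_kspan X.
have [Z' [ZZ' [Z'0 Z'D] Zv' sZ']] := sep_hyperplane s Z0 ZD Zv.
have Z'N x : Z' x -> Z' (- x).
  move=> Zx; rewrite -[- x]addr0 -scaleN1r -(rmorph1 (fdscal A)) -rmorphN.
  exact: Z'D.
have Z'A x y : Z' x -> Z' y -> Z' (x + y).
  by move=> Zx Zy; rewrite -[x]scale1r -(rmorph1 (fdscal A)); apply: Z'D.
have lin a b c x y : Z' (x - fdscal A b *: v) -> Z' (y - fdscal A c *: v) ->
    Z' (fdscal A a *: x + y - fdscal A (a * b + c) *: v).
  move=> h1 h2; have := Z'D a _ _ h1 h2.
  by rewrite rmorphD rmorphM scalerDl -scalerA scalerBr opprD addrACA.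
have ex x : exists a, Z' (x - fdscal A a *: v).
  have [c ->] := sP x; rewrite /kcomb; elim/big_ind: _ => [|y z [b yb] [c' zc]|i _].
  - by exists 0; rewrite rmorph0 scale0r subr0.
  - exists (1 * b + c'); have := lin 1 _ _ _ _ yb zc.
    by rewrite rmorph1 scale1r.
  - have [b h] := sZ' _ (mem_nth 0 (ltn_ord i)); exists (c i * b + 0).
    have := lin (c i) b 0 s`_i 0 h; rewrite rmorph0 scale0r subr0 !addr0.
    exact.
have uniq x a b : Z' (x - fdscal A a *: v) -> Z' (x - fdscal A b *: v) -> a = b.
  move=> h1 h2; apply/eqP; rewrite -subr_eq0; apply/negP => /negP ab0; apply: Zv'.
  have := Z'A _ _ h2 (Z'N _ h1); rewrite opprB addrC addrA subrK -scalerBl -rmorphB => h.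
  have := Z'D (a - b)^-1 _ _ h Z'0.
  by rewrite addr0 scalerA -rmorphM mulVf // rmorph1 scale1r.
have [l lP] := choice ex; exists l; split=> [a x y|x Zx|].
- by apply: (uniq (fdscal A a *: x + y)) => //; apply: lin.
- by apply: (uniq x) => //; rewrite rmorph0 scale0r subr0; apply: ZZ'.
- by apply: (uniq v) => //; rewrite rmorph1 scale1r subrr.
Qed.

(** A surjection from a free module of finite rank onto [P] splits; the [w j] are the coordinates of
    the splitting. *)
Lemma dual_basis P : projective P ->
  exists n (u : 'I_n -> P) (w : 'I_n -> {linear P -> A^o}),
    forall p, p = \sum_j (w j p : A) *: u j.
Proof.
move=> pP; have [s sP] := fgmod_fin_gen P; pose n := size s.
pose F := powmod (regular_mod A) n.
pose f (c : F) : P := \sum_(i < n) (c i : A) *: s`_i.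
have lf : linear f.
  move=> a x y; rewrite /f scaler_sumr -big_split; apply: eq_bigr => i _ /=.
  by rewrite !ffunE scalerDl scalerA.
have [g gE] := linear_pack lf.
have gs : surj g.
  move=> y; have [c ->] := sP y; exists [ffun i : 'I_n => c i : A^o].
  by rewrite gE; apply: eq_bigr => i _; rewrite ffunE.
have [r rE] := pP _ _ g idfun gs.
have /choice[w wE] (j : 'I_n) :
    exists w : {linear P -> A^o}, forall x, w x = r x j.
  have l : linear (fun x => r x j : A^o) by move=> a x y; rewrite linearP !ffunE.
  by have [w wE] := linear_pack l; exists w.
exists n, (fun i => s`_i), w => p.
transitivity (g (r p)); first exact: rE.
by rewrite gE; apply: eq_bigr => i _; rewrite wE.
Qed.

(** * Hom into the dual of the transpose *)

Section Transpose.
Variables (P1 P0 X S : fgmod A) (p1 : {linear P1 -> P0}).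
Variables (Q0 Q1 Y : fgmod A^c).
Variables (e0 : Q0 -> {linear P0 -> A^o}) (e1 : Q1 -> {linear P1 -> A^o}).
Variables (t : {linear Q0 -> Q1}) (c : {linear Q1 -> Y}) (d : S -> Y -> k).
Hypotheses (proj0 : projective P0) (proj1 : projective P1).
Hypotheses (star0 : is_star e0) (star1 : is_star e1).
Hypotheses (tE : forall q, e1 (t q) =1 e0 q \o p1) (cok : is_cokernel c t).
Hypotheses (dk : forall z, klinear (d z)).
Hypotheses (dD : forall z w y, d (z + w) y = d z y + d w y).
Hypotheses (dZ : forall (a : A) z y, d (a *: z) y = d z ((a : A^c) *: y)).
Hypotheses (dI : forall z w, d z =1 d w -> z = w).
Hypotheses (dS : forall phi, klinear phi -> exists z, d z =1 phi).

Let dDr z y y' : d z (y + y') = d z y + d z y'.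
Proof.
rewrite -[d z y]mul1r -dk rmorph1; congr (d z (_ + _)).
exact: (esym (scale1r y)).
Qed.

Let d0r z : d z 0 = 0.
Proof. by apply: (addrI (d z 0)); rewrite -dDr !addr0. Qed.

Let d0l y : d 0 y = 0.
Proof. by apply: (addrI (d 0 y)); rewrite -dD !addr0. Qed.

Let e1D q r x : e1 (q + r) x = e1 q x + e1 r x.
Proof. by case: star1. Qed.

Let e1Z (a : A) q x : e1 ((a : A^c) *: q) x = (e1 q x : A) * a.
Proof. by case: star1. Qed.

Let e10 x : e1 0 x = 0.
Proof. by apply: (addrI (e1 0 x)); rewrite -e1D !addr0. Qed.

(** If [g] does not factor, a functional on Hom(P1, X) kills the maps factoring through [p1] but not
    [g]. Evaluated on the maps q(-)x it gives a pairing of [Q1] and [X] that descends to the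
    transpose, that is, a map from [X] to [S]. This map is zero, which contradicts the value at
    [g]. *)
Lemma factor_of_hom_zero : hom_zero X S ->
  forall g : {linear P1 -> X}, exists h : {linear P0 -> X}, g =1 h \o p1.
Proof.
move=> hXS g; apply: contrapT => ng.
have [n [u [w uE]]] := dual_basis proj1.
(* Hom(P1, X) is embedded in X^n by evaluation at the generators [u j]; [Z] is the image of the maps
   that factor through [p1]. *)
pose V := powmod X n; pose G (f : {linear P1 -> X}) : V := [ffun j => f (u j)].
pose Z (v : V) := exists h : {linear P0 -> X}, forall j, v j = h (p1 (u j)).
have ZD a x y : Z x -> Z y -> Z (fdscal A a *: x + y).
  move=> [h hx] [h' hy].
  have lf : linear (fun p => fdscal A a *: h p + h' p).
    by move=> b p q; rewrite !linearP scalerDr fdscalZ scalerDr addrACA.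
  by have [f fE] := linear_pack lf; exists f => j; rewrite fE !ffunE hx hy.
have Z0 : Z 0 by exists (\0 : {linear P0 -> X}) => j; rewrite ffunE.
have Zg : ~ Z (G g).
  move=> [h hE]; apply: ng; exists h => p /=.
  rewrite [in LHS](uE p) [in RHS](uE p) !linear_sum; apply: eq_bigr => j _.
  by have := hE j; rewrite ffunE !linearZ /= => ->.
have [l [ll lZ lv]] := sep_functional Z0 ZD Zg.
have lD x y : l (x + y) = l x + l y.
  by rewrite -[x in LHS]scale1r -(rmorph1 (fdscal A)) ll mul1r.
have l0 : l 0 = 0 by apply: lZ.
pose b q x := l [ffun j => (e1 q (u j) : A) *: x].
have bD q r x : b (q + r) x = b q x + b r x.
  by rewrite -lD; congr l; apply/ffunP => j; rewrite !ffunE e1D scalerDl.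
have bZ (a : A) q x : b ((a : A^c) *: q) x = b q (a *: x).
  by congr l; apply/ffunP => j; rewrite !ffunE e1Z scalerA.
have bDr q x y : b q (x + y) = b q x + b q y.
  by rewrite -lD; congr l; apply/ffunP => j; rewrite !ffunE scalerDr.
have bk a q x : b q (fdscal A a *: x) = a * b q x.
  rewrite -[RHS]addr0 -l0 -ll addr0; congr l; apply/ffunP => j.
  by rewrite !ffunE fdscalZ.
have bt q x : b (t q) x = 0.
  apply: lZ; have lf : linear (fun p => (e0 q p : A) *: x).
    by move=> a p r; rewrite linearP scalerDl scalerA.
  by have [f fE] := linear_pack lf; exists f => j; rewrite ffunE fE tE.
case: cok => ct /choice[s sE].
have b0 x : b 0 x = 0 by have := bt 0 x; rewrite linear0.
have bN q x : b (- q) x = - b q x.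
  by apply/eqP; rewrite -addr_eq0 -bD addNr b0.
have bs q x : b (s (c q)) x = b q x.
  have [q' q'E] : exists q', t q' = s (c q) - q.
    by apply/ct; rewrite linearB sE subrr.
  by apply/eqP; rewrite -subr_eq0 -bN -bD -q'E bt.
(* As [b] vanishes on the image of [t], the choice of the section [s] of [c] does not matter, and
   b(-, x) is a functional on [Y]. *)
have /choice[f fE] x : exists z, d z =1 (fun y => b (s y) x).
  apply: dS => a y y'; rewrite -{1}[y]sE -{1}[y']sE -linearP bs bD bZ bk.
  by [].
have fE' x q : d (f x) (c q) = b q x by rewrite fE bs.
have lf : linear f.
  move=> a x y; apply: dI => z; rewrite -[z]sE dD dZ fE' -linearZ !fE'.
  by rewrite bDr bZ.
have [F FE] := linear_pack lf.
have bz q x : b q x = 0 by rewrite -fE' -FE hXS d0l.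
(* By the dual basis, [g] is the sum of the maps w_j(-) g(u_j), and [l] takes a value of [b] on each
   of them. *)
have : l (G g) = 0.
  have -> : G g = \sum_j [ffun i => (w j (u i) : A) *: g (u j)].
    apply/ffunP => i; rewrite sum_ffunE ffunE [in LHS](uE (u i)) linear_sum.
    by apply: eq_bigr => j _; rewrite ffunE linearZ.
  elim/big_ind: _ => // [x y hx hy|j _]; first by rewrite lD hx hy addr0.
  case: star1 => _ _ _ /(_ (w j))[q qE]; rewrite -(bz q (g (u j))).
  by congr l; apply/ffunP => i; rewrite !ffunE qE.
by rewrite lv => /eqP; rewrite oner_eq0.
Qed.

(** A map [f] from [X] to [S] is a pairing [b] of [Q1] and [X] vanishing on the image of [t].
    Factoring the map q(-)x through [p1] rewrites b(q, x) as a sum of values of [b] at elements of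
    that image. *)
Lemma hom_zero_of_factor :
  (forall g : {linear P1 -> X}, exists h : {linear P0 -> X}, g =1 h \o p1) ->
  hom_zero X S.
Proof.
move=> fac f x.
have [n [u [w uE]]] := dual_basis proj1.
have [m [u' [w' uE']]] := dual_basis proj0.
case: cok => ct cs.
pose b q x := d (f x) (c q).
have bD q r y : b (q + r) y = b q y + b r y by rewrite /b linearD dDr.
have bZ (a : A) q y : b ((a : A^c) *: q) y = b q (a *: y).
  by rewrite /b linearZ /= -dZ -linearZ.
have bDr q y y' : b q (y + y') = b q y + b q y' by rewrite /b linearD dD.
have b0 y : b 0 y = 0 by rewrite /b linear0 d0r.
have b0r q : b q 0 = 0 by rewrite /b linear0 d0l.
have /choice[v vE] j : exists q, e1 q =1 w j by case: star1.
have /choice[z zE] j : exists q, e0 q =1 w' j by case: star0.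
have qE q : q = \sum_j (e1 q (u j) : A^c) *: v j.
  case: star1 => _ _ eI _; apply: eI => p.
  have -> : e1 (\sum_j (e1 q (u j) : A^c) *: v j) p
      = \sum_j (e1 ((e1 q (u j) : A^c) *: v j) p).
    elim/big_rec2: _ => [|j y q' _ <-]; first exact: e10.
    exact: e1D.
  rewrite [in LHS](uE p) linear_sum; apply: eq_bigr => j _.
  by rewrite linearZ e1Z vE.
have bE q y : b q y = \sum_j b (v j) ((e1 q (u j) : A) *: y).
  rewrite [in LHS](qE q).
  have -> : b (\sum_j (e1 q (u j) : A^c) *: v j) y
      = \sum_j b ((e1 q (u j) : A^c) *: v j) y.
    by elim/big_rec2: _ => [|j y' q' _ <-]; [exact: b0 | exact: bD].
  by apply: eq_bigr => j _; rewrite bZ.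
have bsum q (I : Type) (r : seq I) (F : I -> X) :
    b q (\sum_(i <- r) F i) = \sum_(i <- r) b q (F i).
  by elim/big_rec2: _ => [|j y' q' _ <-]; [exact: b0r | exact: bDr].
apply: dI => y; rewrite d0l; have [q <-] := cs y; rewrite -/(b q x) bE.
have lf : linear (fun p => (e1 q p : A) *: x).
  by move=> a p r; rewrite linearP scalerDl scalerA.
have [g gE] := linear_pack lf; have [h hE] := fac g.
(* [h] is expanded in the dual basis of [P0]; after exchanging the sums, [bE] read backwards
   collects the terms into b(t(z_i), h(u'_i)). *)
transitivity (\sum_j \sum_i b (v j) ((e1 (t (z i)) (u j) : A) *: h (u' i))).
  apply: eq_bigr => j _; rewrite -bsum; congr b.
  rewrite -[LHS](gE (u j)) hE /= [in LHS](uE' (p1 (u j))) linear_sum.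
  by apply: eq_bigr => i _; rewrite linearZ tE /= zE.
rewrite exchange_big big1 // => i _; rewrite -bE /b.
by have /ct -> : exists q', t q' = t (z i); [exists (z i) | exact: d0r].
Qed.

End Transpose.

Lemma tau_pres M T : is_tau M T ->
  exists (P1 P0 : fgmod A) (p1 : {linear P1 -> P0}) (p0 : {linear P0 -> M}),
    min_proj_pres p1 p0 /\
    forall X, hom_zero X T <->
      forall g : {linear P1 -> X}, exists h : {linear P0 -> X}, g =1 h \o p1.
Proof.
move=> [Y [[P1 [P0 [p1 [p0 [Q0 [Q1 [e0 [e1 [t [c [mp s0 s1 tE cok]]]]]]]]]]]]].
move=> [d [dk dD dZ dI dS]].
exists P1, P0, p1, p0; split=> // X.
case: (mp) => -[pr0 _ _] [K [i [q [_ [pr1 _ _] _]]]].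
split; first exact: (factor_of_hom_zero pr1 s1 tE cok).
exact: (hom_zero_of_factor pr0 pr1 s0 s1 tE cok).
Qed.

End HomTau.

(** * Transport along the equivalence with a module category *)

Section Transport.
Variables (k : fieldType) (A B : fdalg k) (W : subcat B).
Variables (wW : wide W) (F : equivalence A W).
Implicit Types (M N X P : fgmod A).

(** [F] acts on bundled maps, so invariance under [=1] has to be derived; k-linearity with scalar 0
    gives it. *)
Lemma eqv_ext M N (f g : {linear M -> N}) :
  f =1 g -> eqv_hom F f =1 eqv_hom F g.
Proof.
move=> fg y; have h x : f x = fdscal A 0 *: f x + g x.
  by rewrite rmorph0 scale0r add0r.
by rewrite (eqv_klinear (e := F) h) rmorph0 scale0r add0r.
Qed.

Lemma eqv_zero M N (f : {linear M -> N}) :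
  (forall x, f x = 0) <-> (forall y, eqv_hom F f y = 0).
Proof.
have zero (g : {linear M -> N}) : (forall x, g x = 0) -> forall y, eqv_hom F g y = 0.
  move=> g0 y; have h x : g x = fdscal A 1 *: g x + g x.
    by rewrite !g0 scaler0 addr0.
  have := eqv_klinear (e := F) h y; rewrite rmorph1 scale1r => /eqP.
  by rewrite -[X in X == _]addr0 (inj_eq (addrI _)) eq_sym => /eqP.
split; first exact: zero.
move=> f0 x; have := @eqv_faithful _ _ _ _ F M N f \0; apply=> y.
by rewrite f0 zero.
Qed.

Lemma eqv_compE M N X (f : {linear M -> N}) (g : {linear N -> X}) y :
  eqv_hom F (g \o f) y = eqv_hom F g (eqv_hom F f y).
Proof. exact: eqv_comp. Qed.

Lemma eqv_obj (X : fgmod B) : W X ->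
  exists (X' : fgmod A) (a : {linear F X' -> X}) (b : {linear X -> F X'}),
    cancel a b /\ cancel b a.
Proof.
move=> /(eqv_ess_surj F)[X' [a /bijE[ai as']]].
by have [b ab] := linear_inv ai as'; exists X', a, b.
Qed.

(** Surjectivity means that the cokernel map vanishes. Cokernels of maps in [W] stay in [W], hence
    come from [A]-modules, and [F] preserves and reflects zero maps. *)
Lemma eqv_surj M N (f : {linear M -> N}) : surj (eqv_hom F f) <-> surj f.
Proof.
case: (wW) => _ _ Wc _; split=> sf.
  have [Q [p [pf ps]]] := coker_fg f; move=> y; apply/pf; move: y.
  apply/eqv_zero => y; have [x <-] := sf y; rewrite -eqv_compE.
  move: x; apply/eqv_zero => x /=; apply/pf.
  by exists x.
have [Q [p [pf ps]]] := coker_fg (eqv_hom F f).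
have WQ : W Q by apply: (Wc _ _ _ _ _ (conj pf ps)); apply: eqv_in.
have [Q' [a [b [ab ba]]]] := eqv_obj WQ.
have [p' p'E] := eqv_full (b \o p : {linear F N -> F Q'}).
have p'0 y : p' y = 0.
  have [x <-] := sf y; rewrite -[LHS]/((p' \o f) x); move: x.
  apply/eqv_zero => x; rewrite eqv_compE p'E /=.
  by have /pf -> : exists z, eqv_hom F f z = eqv_hom F f x; [exists x | rewrite linear0].
move=> y; apply/pf; apply: (can_inj ba); rewrite linear0 -[LHS]/((b \o p) y) -p'E.
by move: y; apply/eqv_zero.
Qed.

Lemma eqv_inj M N (f : {linear M -> N}) :
  injective f -> injective (eqv_hom F f).
Proof.
case: (wW) => _ Wk _ _ fi; apply: linear_inj => x fx.
have [K [i ik]] := ker_fg (eqv_hom F f).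
have WK : W K by apply: (Wk _ _ _ _ _ ik); apply: eqv_in.
have [K' [a [b [ab ba]]]] := eqv_obj WK.
have [i' i'E] := eqv_full (i \o a : {linear _ -> _}).
case: ik => _ iE; have [z <-] := (iE x).1 fx.
have i'0 y : i' y = 0.
  apply: fi; rewrite linear0 -[LHS]/((f \o i') y); move: y.
  by apply/eqv_zero => y; rewrite eqv_compE i'E; apply/iE; exists (a y).
by rewrite -(ba z) -[LHS]/((i \o a) (b z)) -i'E; apply: (eqv_zero i').1.
Qed.

Lemma eqv_kernel M N P (i : {linear M -> N}) (f : {linear N -> P}) :
  is_kernel i f -> is_kernel (eqv_hom F i) (eqv_hom F f).
Proof.
case: (wW) => _ Wk _ _ [ii fi]; split; first exact: eqv_inj.
move=> y; split=> [fy|[x <-]]; last first.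
  rewrite -eqv_compE; move: x; apply/eqv_zero => x /=; apply/fi.
  by exists x.
have [K [j jk]] := ker_fg (eqv_hom F f).
have WK : W K by apply: (Wk _ _ _ _ _ jk); apply: eqv_in.
have [K' [a [b [ab ba]]]] := eqv_obj WK.
have [j' j'E] := eqv_full (j \o a : {linear _ -> _}).
case: jk => _ jE; have [z <-] := (jE y).1 fy.
have [l lE] : exists l : {linear K' -> M}, forall z, i (l z) = j' z.
  apply: linear_lift => // x; apply/fi; rewrite -[LHS]/((f \o j') x); move: x.
  by apply/eqv_zero => x; rewrite eqv_compE j'E; apply/jE; exists (a x).
exists (eqv_hom F l (b z)); rewrite -eqv_compE (eqv_ext (f := i \o l) (g := j') lE) j'E /=.
by rewrite ba.
Qed.

Lemma eqv_hom_obj P (X : fgmod B) (X' : fgmod A) (a : {linear F X' -> X})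
    (b : {linear X -> F X'}) (f : {linear F P -> X}) :
  cancel b a -> exists f' : {linear P -> X'}, forall x, a (eqv_hom F f' x) = f x.
Proof.
move=> ba; have [f' f'E] := eqv_full (b \o f : {linear _ -> _}).
by exists f' => x; rewrite f'E /= ba.
Qed.

End Transport.

(* By [pres_hom_tau], Hom(X, tau_W M) = 0 iff Hom(pmap1, X) is surjective: in
   fact Hom(X, tau_W M) is dual to the cokernel of Hom(pmap1, X). *)
Record tau_presentation (A : pzRingType) (W : subcat A) (M T : fgmod A) :=
  TauPresentation {
  pres1 : fgmod A;
  pres0 : fgmod A;
  pmap1 : {linear pres1 -> pres0};
  pmap0 : {linear pres0 -> M};
  pres1_in : W pres1;
  pres0_in : W pres0;
  pres0_proj : forall (X Y : fgmod A) (p : {linear X -> Y}) (f : {linear pres0 -> Y}),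
    W X -> W Y -> surj p -> exists g : {linear pres0 -> X}, forall x, p (g x) = f x;
  pmap0_surj : surj pmap0;
  pmap_exact : exact pmap1 pmap0;
  pmap1_superfluous : forall (X : fgmod A) (f : {linear X -> pres1}), W X ->
    (forall x, exists z, pmap1 (f z) = pmap1 x) -> surj f;
  pres_hom_tau : forall X : fgmod A, W X -> (hom_zero X T <->
    forall g : {linear pres1 -> X}, exists h : {linear pres0 -> X},
      forall x, g x = h (pmap1 x))
}.

Lemma tau_in_pres (k : fieldType) (L : fdalg k) (W : subcat L) (M T : fgmod L) :
  wide W -> is_tau_in W M T -> inhabited (tau_presentation W M T).
Proof.
move=> wW [A [F [N [S [[u /bijE[ui us]] tauN [v /bijE[vi vs]]]]]]].
have [P1 [P0 [p1 [p0 [[[pr0 p0s _] [K [i [q [ik [_ qs qm] p1E]]]]] hp]]]]] := tau_pres tauN.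
have [u' [uu' u'u]] := linear_inv ui us.
have [v' [vv' v'v]] := linear_inv vi vs.
constructor.
exists (F P1) (F P0) (eqv_hom F p1) (u \o eqv_hom F p0 : {linear _ -> _}).
- exact: eqv_in.
- exact: eqv_in.
- move=> X Y p f /(eqv_obj F)[X' [a [b [ab ba]]]] /(eqv_obj F)[Y' [a' [b' [ab' ba']]]] ps.
  have [p' p'E] := eqv_full (b' \o (p \o a) : {linear _ -> _}).
  have [f' f'E] := eqv_hom_obj f ba'.
  have p's : surj p'.
    apply/(eqv_surj wW F) => y; have [x xE] := ps (a' y).
    by exists (b x); rewrite p'E /= ba xE ab'.
  have [g gE] := pr0 _ _ p' f' p's.
  exists (a \o eqv_hom F g : {linear _ -> _}) => x /=.
  apply: (can_inj ba'); rewrite -[LHS]/((b' \o (p \o a)) (eqv_hom F g x)) -p'E.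
  by rewrite -eqv_compE -(eqv_ext (F := F) gE) -f'E ab'.
- move=> y; have [x <-] := us y.
  have /(_ x)[z <-] : surj (eqv_hom F p0) by apply/(eqv_surj wW F).
  by exists z.
- have [_ ex] := eqv_kernel wW F ik => y; split=> /=.
    rewrite -(linear0 u) => /ui/ex[x <-].
    have /(_ x)[z <-] : surj (eqv_hom F q) by apply/(eqv_surj wW F).
    by exists z; rewrite -eqv_compE (eqv_ext (F := F) p1E).
  case=> x <-; rewrite (_ : eqv_hom F p0 _ = 0) ?linear0 //; apply/ex.
  by exists (eqv_hom F q x); rewrite (eqv_ext (F := F) p1E) eqv_compE.
- move=> X f /(eqv_obj F)[X' [a [b [ab ba]]]] h.
  have [f' f'E] := eqv_full (f \o a : {linear _ -> _}).
  have : surj f'.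
    apply: qm; apply/(eqv_surj wW F) => y.
    have /(_ y)[x <-] : surj (eqv_hom F q) by apply/(eqv_surj wW F).
    have [z zE] := h x; exists (b z); rewrite eqv_compE f'E /= ba.
    have ii : injective (eqv_hom F i) by apply: (eqv_inj wW); case: ik.
    by apply: ii; rewrite -!eqv_compE -!(eqv_ext (F := F) p1E).
  move/(eqv_surj wW F) => f's y; have [x <-] := f's y.
  by exists (a x); rewrite f'E.
- move=> X /(eqv_obj F)[X' [a [b [ab ba]]]]; split=> [hX|hX].
    have hX' : hom_zero X' S.
      move=> f; apply/(eqv_zero F) => y; apply: vi; rewrite linear0.
      rewrite -[y]ab.
      exact: (hX (v \o (eqv_hom F f \o b) : {linear _ -> _})).
    move=> g; have [g' g'E] := eqv_hom_obj g ba.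
    have [h hE] := (hp X').1 hX' g'; exists (a \o eqv_hom F h : {linear _ -> _}) => x /=.
    by rewrite -eqv_compE -(eqv_ext (F := F) hE) g'E.
  have hX' : hom_zero X' S.
    apply/hp => g; have [h hE] := hX (a \o eqv_hom F g : {linear _ -> _}).
    have [h' h'E] := eqv_hom_obj h ba; exists h'.
    apply: (@eqv_faithful _ _ _ _ F) => x; apply: (can_inj ab).
    by rewrite eqv_compE h'E -hE.
  move=> f x; have [f' f'E] := eqv_full (v' \o (f \o a) : {linear _ -> _}).
  apply: (can_inj v'v); rewrite linear0 -[x]ba -[LHS]/((v' \o (f \o a)) (b x)) -f'E.
  by apply: (eqv_zero F f').1; apply: hX'.
Qed.

(** * Torsion classes *)

Section WideTorsion.
Variables (k : fieldType) (L : fdalg k) (W : subcat L) (wW : wide W).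
Implicit Types (M N X Y Z K I E B Q S : fgmod L) (V C : subcat L).

Lemma wide_ker K M N (i : {linear K -> M}) (f : {linear M -> N}) :
  is_kernel i f -> W M -> W N -> W K.
Proof. by case: wW => _ h _ _; apply: h. Qed.

Lemma wide_coker M N Q (f : {linear M -> N}) (p : {linear N -> Q}) :
  is_cokernel p f -> W M -> W N -> W Q.
Proof. by case: wW => _ _ h _; apply: h. Qed.

Lemma wide_ext M N X (i : {linear M -> N}) (p : {linear N -> X}) :
  short_exact i p -> W M -> W X -> W N.
Proof. by case: wW => _ _ _; apply. Qed.

(** The image lies in [W] as the kernel of the cokernel. *)
Lemma wide_im M N (f : {linear M -> N}) : W M -> W N ->
  exists I (q : {linear M -> I}) (j : {linear I -> N}),
    [/\ W I, surj q, injective j & forall x, f x = j (q x)].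
Proof.
move=> WM WN; have [I [q [j [qs ji fE]]]] := im_fg f; exists I, q, j; split=> //.
have [Q [p [pf ps]]] := coker_fg f.
apply: (@wide_ker I N Q j p) => //; last exact: (wide_coker (conj pf ps)).
split=> // y; rewrite pf; split=> [[x <-]|[x <-]].
  by exists (q x); rewrite -fE.
by have [z <-] := qs x; exists z; rewrite fE.
Qed.

Section TorsionClass.
Variables (T : subcat L) (tT : torsion_class W T).

Lemma tors_in X : T X -> W X. Proof. by case: tT => h _ _; apply: h. Qed.

Lemma tors_ext M N X (i : {linear M -> N}) (p : {linear N -> X}) :
  short_exact i p -> T M -> T X -> T N.
Proof. by case: tT => _ h _; apply: h. Qed.

Lemma tors_quot X Y (p : {linear X -> Y}) : T X -> W Y -> surj p -> T Y.
Proof.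
move=> TX WY ps; case: tT => TW _ ->; split=> //.
have [_ [n [Z [S [q [TZ dZ sq]]]]]] := sub_Gen TW TX.
exists n, Z, S, (p \o q : {linear _ -> _}); split=> // y.
by have [x <-] := ps y; have [z <-] := sq x; exists z.
Qed.

Lemma tors_zero Z : W Z -> zero_mod Z -> T Z.
Proof.
move=> WZ Z0; case: tT => _ _ ->; split=> //.
exists 0%N, (fun=> Z), Z, idfun; split=> [[]//||y]; last by exists y.
exists (fun=> idfun) => x; exists (fun=> 0); split; first by rewrite big_ord0 [x]Z0.
by move=> y _; apply: functional_extensionality_dep => -[].
Qed.

(** Supplies the intermediate classes on which the covering relation is tested. *)
Lemma tors_perp N : torsion_class W (fun X => T X /\ hom_zero X N).
Proof.
split=> [X [/tors_in]//|A E B i p sip [TA hA] [TB hB]|X].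
  split; first exact: tors_ext sip TA TB.
  case: sip => ii ex ps f.
  have [g gE] : exists g : {linear B -> N}, forall x, g (p x) = f x.
    apply: linear_desc => // x /ex[a <-]; exact: (hA (f \o i : {linear _ -> _})).
  by move=> x; rewrite -gE hB.
split=> [h|[WX [n [Y [S [p [CY [h hE] ps]]]]]]].
  by apply: (@sub_Gen _ W (fun X => T X /\ hom_zero X N)) => // Z [/tors_in].
split.
  case: tT => _ _ ->; split=> //; exists n, Y, S, p; split=> // [i|]; first by case: (CY i).
  by exists h.
move=> f x; have [s <-] := ps x; have [y [-> _]] := hE s.
rewrite !linear_sum big1 // => i _; have [_ hY] := CY i.
exact: (hY (f \o (p \o h i) : {linear _ -> _})).
Qed.

(** [F0] is a quotient of least dimension with kernel in [T]. A nonzero map from [T] to [F0] with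
    image [I] would give the smaller quotient F0/I, whose kernel is an extension of [I] by [T0] and
    so lies in [T]. *)
Lemma torsion_decomp X : W X ->
  exists (T0 F0 : fgmod L) (i : {linear T0 -> X}) (p : {linear X -> F0}),
    [/\ short_exact i p, T T0, W F0 & forall Z, T Z -> hom_zero Z F0].
Proof.
move=> WX.
pose C Y := exists (T0 : fgmod L) (i : {linear T0 -> X}) (p : {linear X -> Y}),
  [/\ short_exact i p, T T0 & W Y].
have [|F0 [[T0 [i [p [sip TT0 WF]]]] minF]] := @min_dim _ _ C.
  have [K [i [ii iE]]] := ker_fg (idfun : {linear X -> X}).
  have K0 : zero_mod K.
    by move=> x; apply: ii; rewrite linear0; apply/(iE (i x)); exists x.
  exists X, K, i, idfun; split=> //; first by split=> // x; exists x.
  by apply: tors_zero => //; apply: (@wide_ker K X X i idfun).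
exists T0, F0, i, p; split=> // Z TZ f z; apply: contrapT => fz.
have [I [q [j [WI qs ji fE]]]] := wide_im f (tors_in TZ) WF.
have TI : T I by apply: (tors_quot TZ WI qs).
have [Y [r [rj rs]]] := coker_fg j.
have WY : W Y by apply: (wide_coker (conj rj rs)).
have rf : r (f z) = 0 by apply/rj; exists (q z); rewrite fE.
have := dim_surj_lt rs rf fz; rewrite ltnNge minF //.
case: (sip) => ii ex ps.
have [K [i' [ii' ex']]] := ker_fg (r \o p : {linear _ -> _}).
exists K, i', (r \o p : {linear _ -> _}); split=> //.
  by split=> // y; have [x <-] := rs y; have [x' <-] := ps x; exists x'.
have [u uE] : exists u : {linear T0 -> K}, forall x, i' (u x) = i x.
  apply: linear_lift => // x; apply/ex' => /=.
  by have -> : p (i x) = 0; [apply/ex; exists x | rewrite linear0].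
have [v vE] : exists v : {linear K -> I}, forall x, j (v x) = p (i' x).
  apply: (linear_lift (f := p \o i' : {linear _ -> _})) => // x.
  apply/rj; apply/(ex' (i' x)).
  by exists x.
apply: (@tors_ext T0 K I u v) => //; split.
- by move=> x y uxy; apply: ii; rewrite -!uE uxy.
- move=> y; split=> [vy|[x <-]].
    have /ex[x xE] : p (i' y) = 0 by rewrite -vE vy linear0.
    by exists x; apply: ii'; rewrite uE.
  by apply: ji; rewrite vE uE linear0; apply/ex; exists x.
- move=> y; have [x xE] := ps (j y).
  have /ex'[x' x'E] : (r \o p) x = 0 by rewrite /= xE; apply/rj; exists y.
  by exists x'; apply: ji; rewrite vE x'E.
Qed.

(** [B] has least dimension in V \ T. A nonzero map from [T] to [B] would make the torsion part of
    [B] nonzero; then the torsion-free quotient is smaller, lies in [T], and forces [B] into [T]. *)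
Lemma minimal_outside V : torsion_class W V -> ~ subcat_le V T ->
  exists B, [/\ V B, ~ T B, forall Y, V Y -> (dim Y < dim B)%N -> T Y
    & forall Z, T Z -> hom_zero Z B].
Proof.
move=> tV nVT; have [|B [[VB nTB] minB]] := @min_dim _ _ (fun B => V B /\ ~ T B).
  apply: contrapT => h; apply: nVT => X VX; apply: contrapT => nTX.
  by apply: h; exists X.
have small Y : V Y -> (dim Y < dim B)%N -> T Y.
  move=> VY lt; apply: contrapT => nTY; have := minB Y (conj VY nTY).
  by rewrite leqNgt lt.
exists B; split=> // Z TZ f z.
have WB : W B by case: tV => h _ _; apply: h.
have [T0 [F0 [i [p [sip TT0 WF hF]]]]] := torsion_decomp WB.
have VF : V F0.
  case: tV => VW _ VG; apply/VG; split=> //.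
  have [_ [n [Y [S [q [VY dY sq]]]]]] := sub_Gen VW VB.
  exists n, Y, S, (p \o q : {linear _ -> _}); split=> // y.
  case: sip => _ _ ps; have [x <-] := ps y; have [x' <-] := sq x.
  by exists x'.
case: (sip) => ii ex ps.
have [x xE] : exists x, i x = f z by apply/ex; apply: (hF Z TZ (p \o f : {linear _ -> _})).
apply: contrapT => fz; apply: nTB; apply: (tors_ext sip) => //.
by apply: small => //; apply: (dim_surj_lt (x := f z)) => //; apply/ex; exists x.
Qed.

End TorsionClass.

(** Membership in the trace of [M] in [X]; through [Gen1P] it replaces quotients of direct sums by
    elementwise computations. *)
Definition trace M X (x : X) : Prop :=
  exists l : seq ({linear M -> X} * M), x = \sum_(u <- l) u.1 u.2.

Lemma trace_mem M X (f : {linear M -> X}) m : trace M (f m).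
Proof. by exists [:: (f, m)]; rewrite big_seq1. Qed.

Lemma trace_submod M X : submod (@trace M X).
Proof.
split=> [|a x y [l ->] [l' ->]]; first by exists [::]; rewrite big_nil.
exists ([seq (u.1, a *: u.2) | u <- l] ++ l').
rewrite big_cat big_map scaler_sumr /=; congr (_ + _).
by apply: eq_bigr => u _; rewrite linearZ.
Qed.

Lemma trace_map M X Y (f : {linear X -> Y}) x : trace M x -> trace M (f x).
Proof.
move=> [l ->]; rewrite linear_sum; apply: submod_sum; first exact: trace_submod.
by move=> u; apply: (trace_mem (f \o u.1 : {linear _ -> _})).
Qed.

Lemma powmod_direct M n : direct_sum (fun _ : 'I_n => M) (powmod M n).
Proof.
have /choice[h hE] (i : 'I_n) : exists h : {linear M -> powmod M n},
    forall x, h x = [ffun j => if j == i then x else 0].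
  have lh : linear (fun x => [ffun j => if j == i then x else 0] : powmod M n).
    move=> a x y; apply/ffunP => j; rewrite !ffunE.
    by case: eqP => // _; rewrite scaler0 addr0.
  by have [h hE] := linear_pack lh; exists h.
have sumE (y : 'I_n -> M) : \sum_i h i (y i) = [ffun i => y i].
  apply/ffunP => j; rewrite sum_ffunE (bigD1 j) //= hE !ffunE eqxx big1 ?addr0 //.
  by move=> i ij; rewrite hE ffunE eq_sym (negPf ij).
exists h => x; exists x; split=> [|y]; rewrite sumE.
  by apply/ffunP => i; rewrite ffunE.
by move=> ->; apply: functional_extensionality_dep => i; rewrite ffunE.
Qed.

Lemma Gen1P M X : Gen1 W M X <-> W X /\ forall x : X, trace M x.
Proof.
split=> [[WX [n [Y [S [p [MY [h hE] ps]]]]]]|[WX tr]]; split=> //.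
  move=> x; have [s <-] := ps x; have [y [-> _]] := hE s.
  rewrite linear_sum; apply: submod_sum; first exact: trace_submod.
  (* The summands are only propositionally equal to [M], so the equality is eliminated in a
     generalized statement. *)
  move=> i; have trN N (g : {linear N -> X}) z : M = N -> trace M (g z).
    by move=> MN; subst N; apply: trace_mem.
  exact: (trN _ (p \o h i : {linear _ -> _}) (y i) (MY i)).
have [s sP] := fgmod_fin_gen X.
have /choice[l lE] (i : 'I_(size s)) := tr s`_i.
(* One copy of [M] for every term in the trace expansion of every generator of [X]. *)
pose J := {i : 'I_(size s) & 'I_(size (l i))}.
pose u (j : J) := nth (\0 : {linear M -> X}, 0) (l (tag j)) (tagged j).
pose F (v : powmod M #|{: J}|) : X := \sum_j (u j).1 (v (enum_rank j)).
have lF : linear F.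
  move=> a x y; rewrite /F scaler_sumr -big_split; apply: eq_bigr => j _ /=.
  by rewrite !ffunE linearP.
have [f fE] := linear_pack lF.
exists #|{: J}|, (fun=> M), (powmod M #|{: J}|), f; split=> // [|x].
  exact: powmod_direct.
have [c ->] := sP x.
exists [ffun r : 'I_#|{: J}| => c (tag (enum_val r : J)) *: (u (enum_val r)).2].
pose G i (t : 'I_(size (l i))) :=
  c i *: (u (Tagged (fun i => 'I_(size (l i))) t)).1
           (u (Tagged (fun i => 'I_(size (l i))) t)).2.
transitivity (\sum_i \sum_t G i t).
  rewrite sig_big_dep /= fE /F; apply: eq_bigr => -[i t] _.
  by rewrite ffunE enum_rankK linearZ.
apply: eq_bigr => i _; rewrite -scaler_sumr [in RHS]lE; congr (_ *: _).
by rewrite (big_nth (\0 : {linear M -> X}, 0)) big_mkord.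
Qed.

End WideTorsion.

(** * Torsion classes of a tau-rigid module *)

Section TauRigid.
Variables (k : fieldType) (L : fdalg k) (W : subcat L) (wW : wide W).
Variables (M tauM : fgmod L) (P : tau_presentation W M tauM) (WM : W M).
Implicit Types (N X Y Z K I E B Q S : fgmod L).

(** Vanishing of Ext^1(M, K) in lifting form. A lift [a] of the map from P0 sends the image of
    [pmap1] into [K]; that restriction extends to [h] on P0, and a - ih descends to [M]. *)
Lemma lift_perp E Z K (i : {linear K -> E}) (p : {linear E -> Z})
    (f : {linear M -> Z}) :
  short_exact i p -> W E -> W Z -> hom_zero K tauM ->
  exists g : {linear M -> E}, forall x, p (g x) = f x.
Proof.
case=> ii ex ps WE WZ hK.
have WK : W K by apply: (wide_ker wW (conj ii ex)).
have [a aE] := pres0_proj (t := P) (f \o pmap0 P : {linear _ -> _}) WE WZ ps.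
have pe := @pmap_exact _ _ _ _ P.
have [b bE] : exists b : {linear pres1 P -> K}, forall x, i (b x) = a (pmap1 P x).
  apply: (linear_lift (f := a \o pmap1 P : {linear _ -> _})) => // x /=.
  apply/ex; rewrite aE /= (_ : pmap0 P _ = 0) ?linear0 //.
  by apply/pe; exists x.
have [h hE] := (pres_hom_tau P WK).1 hK b.
have [g gE] : exists g : {linear M -> E}, forall x, g (pmap0 P x) = a x - i (h x).
  apply: (linear_desc (f := (a \- (i \o h))%R : {linear _ -> _})).
    exact: pmap0_surj.
  by move=> y /pe[x <-] /=; rewrite -hE bE subrr.
exists g => x; have [y <-] := pmap0_surj P x; rewrite gE linearB aE /=.
by rewrite (_ : p (i _) = 0) ?subr0 //; apply/ex; exists (h y).
Qed.

(** A map from P1 to [K] extends to [h] from P0 to [B]; then ph descends to [M], hence is zero, and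
    [h] lands in [K]. *)
Lemma ker_perp K B I (i : {linear K -> B}) (p : {linear B -> I}) :
  is_kernel i p -> W B -> W I -> hom_zero B tauM -> hom_zero M I ->
  hom_zero K tauM.
Proof.
move=> [ii ex] WB WI hB hM.
have WK : W K by apply: (wide_ker wW (conj ii ex)).
apply/(pres_hom_tau P WK) => g.
have [h hE] := (pres_hom_tau P WB).1 hB (i \o g : {linear _ -> _}).
have pe := @pmap_exact _ _ _ _ P.
have [f fE] : exists f : {linear M -> I}, forall x, f (pmap0 P x) = p (h x).
  apply: (linear_desc (f := p \o h : {linear _ -> _})).
    exact: pmap0_surj.
  by move=> _ /pe[x <-] /=; rewrite -hE; apply/ex; exists (g x).
have [h' h'E] : exists h' : {linear pres0 P -> K}, forall x, i (h' x) = h x.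
  by apply: linear_lift => // x; apply/ex; rewrite -fE hM.
by exists h' => x; apply: ii; rewrite h'E -hE.
Qed.

Lemma perp_tors N : torsion_class W (fun X => W X /\ hom_zero X N).
Proof. by apply: tors_perp => //; exact: torsion_class_self. Qed.

Hypothesis rigid : hom_zero M tauM.

Lemma Gen1_perp X : Gen1 W M X -> hom_zero X tauM.
Proof.
move=> /Gen1P[_ tr] f x; have [l ->] := tr x; rewrite linear_sum big1 // => u _.
exact: (rigid (f \o u.1 : {linear _ -> _})).
Qed.

Lemma Gen1_quot X Y (p : {linear X -> Y}) :
  Gen1 W M X -> W Y -> surj p -> Gen1 W M Y.
Proof.
move=> /Gen1P[_ tr] WY ps; apply/Gen1P; split=> // y.
by have [x <-] := ps y; apply: trace_map.
Qed.

Lemma Gen1_self : Gen1 W M M.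
Proof. by apply/Gen1P; split=> // x; apply: (trace_mem idfun). Qed.

(** For extensions, rigidity lets the maps from [M] to the quotient lift to the middle term, so an
    element differs from a trace element by one of the submodule. *)
Lemma Gen1_tors : torsion_class W (Gen1 W M).
Proof.
split=> [X []//|X E Z i p sip GX GZ|X].
  have WE : W E by apply: (wide_ext wW sip); [case: GX | case: GZ].
  have hX := Gen1_perp GX; case/Gen1P: GX => WX trX; case/Gen1P: GZ => WZ trZ.
  apply/Gen1P; split=> // e; have [l lE] := trZ (p e).
  have /choice[g gE] (f : {linear M -> Z}) := lift_perp f sip WE WZ hX.
  case: (sip) => ii ex ps; pose s := \sum_(u <- l) g u.1 u.2.
  have /ex[x xE] : p (e - s) = 0.
    by rewrite linearB lE linear_sum (eq_bigr _ (fun u _ => gE u.1 u.2)) subrr.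
  rewrite -(subrK s e) -xE; apply: submodD; first exact: trace_submod.
    by apply: trace_map.
  by apply: submod_sum; [exact: trace_submod | move=> u; apply: trace_mem].
split=> [|[WX [n [Y [S [p [GY [h hE] ps]]]]]]].
  by apply: sub_Gen => Y [].
apply/Gen1P; split=> // x; have [s <-] := ps x; have [y [-> _]] := hE s.
rewrite linear_sum; apply: submod_sum; first exact: trace_submod.
move=> i; do 2!apply: trace_map; by case/Gen1P: (GY i).
Qed.

End TauRigid.

(** * Split projectives of Gen M *)

Section Local.
Variables (k : fieldType) (L : fdalg k).
Implicit Types (M X Y Z K I E B Q S : fgmod L).

Fixpoint iterl Y (e : {linear Y -> Y}) n : {linear Y -> Y} :=
  if n is n'.+1 then (e \o iterl e n' : {linear _ -> _}) else idfun.

Lemma iterlE Y (e : {linear Y -> Y}) n x : iterl e n x = iter n e x.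
Proof. by elim: n => //= n ->. Qed.

(** A power whose image has least dimension has the same image as its square. *)
Lemma image_stabilizes Y (e : {linear Y -> Y}) : exists n, forall x,
  exists y, iter n.+1 e x = iter n.+1 e (iter n.+1 e y).
Proof.
pose C I := exists n (q : {linear Y -> I}) (j : {linear I -> Y}),
  [/\ surj q, injective j & forall x, iter n.+1 e x = j (q x)].
have exC n : exists I (q : {linear Y -> I}) (j : {linear I -> Y}),
    [/\ surj q, injective j & forall x, iter n.+1 e x = j (q x)].
  have [I [q [j [qs ji jE]]]] := im_fg (iterl e n.+1).
  by exists I, q, j; split=> // x; rewrite -iterlE.
have [|I [[n [q [j [qs ji jE]]]] minI]] := @min_dim _ _ C.
  by have [I [q [j h]]] := exC 0%N; exists I, 0%N, q, j.
(* The exponent (n + n.+1).+1 is twice n.+1. *)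
exists n; have [I' [q' [j' [qs' ji' jE']]]] := exC (n + n.+1)%N.
have jE2 x : j' (q' x) = iter n.+1 e (iter n.+1 e x) by rewrite -jE' -iterD addSn.
have [u uE] : exists u : {linear I' -> I}, forall z, j (u z) = j' z.
  apply: linear_lift => // z; have [x <-] := qs' z.
  by exists (q (iter n.+1 e x)); rewrite jE2 jE.
have ui : injective u by move=> z w uzw; apply: ji'; rewrite -!uE uzw.
have us : surj u.
  move=> z; apply: contrapT => /forallNP nz.
  have := dim_inj_lt ui nz; rewrite ltnNge minI //.
  by exists (n + n.+1)%N, q', j'.
move=> x; have [z zE] := us (q x); have [y yE] := qs' z.
by exists y; rewrite -jE2 yE -uE zE jE.
Qed.

(** When [g] and its square have the same image, [Y] is the direct sum of the kernel and the image
    of [g], and one of them vanishes. *)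
Lemma fitting Y (g : {linear Y -> Y}) : indecomposable Y ->
  (forall x, exists y, g x = g (g y)) -> injective g \/ forall x, g x = 0.
Proof.
move=> [_ ind] gg.
have [K [i [ii iE]]] := ker_fg g; have [I [q [j [qs ji gE]]]] := im_fg g.
have vi : injective (q \o j : {linear _ -> _}).
  apply: inj_of_surj => // z; have [x <-] := qs z; have [y xy] := gg x.
  by exists (q y); apply: ji; rewrite /= -!gE -xy.
pose h (b : bool) : {linear (if b then K else I) -> Y} :=
  match b return {linear (if b then K else I) -> Y} with true => i | false => j end.
have dY : direct_sum (fun b : bool => if b then K else I) Y.
  exists h => x; have [y xy] := gg x.
  have /iE[a aE] : g (x - g y) = 0 by rewrite linearB -xy subrr.
  exists (fun b => match b return if b then K else I with true => a | false => q y end).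
  split; first by rewrite big_bool /= aE -gE subrK.
  move=> z; rewrite big_bool /= => xE.
  have ga w : g (i w) = 0 by apply/iE; exists w.
  have qE : q y = z false.
    apply: vi; apply: ji; rewrite /= -!gE -xy xE linearD ga add0r.
    by [].
  apply: functional_extensionality_dep => -[] //.
  by apply: ii; rewrite aE xE gE qE addrK.
case: (ind K I dY) => [K0|I0]; [left|right] => [|x].
  by apply: linear_inj => x /iE[z <-]; rewrite (K0 z) linear0.
by rewrite gE (I0 (q x)) linear0.
Qed.

(** * Non-units of the local ring End(Y) *)

Section NonUnits.
Variables (Y : fgmod L) (ind : indecomposable Y).
Implicit Types (e f : {linear Y -> Y}).

Lemma nonunit_nilpotent e : ~ injective e -> exists n, forall x, iter n e x = 0.
Proof.
move=> ne; have [n h] := image_stabilizes e; exists n.+1.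
have [|inj|z x] := @fitting Y (iterl e n.+1) ind.
- by move=> x; have [y yE] := h x; exists y; rewrite !iterlE.
- case: ne => x y xy; apply: inj; rewrite !iterlE !iterSr xy.
  by [].
- by rewrite -iterlE.
Qed.

Lemma nonunit_sub e : ~ injective e -> injective (idfun \- e : {linear Y -> Y}).
Proof.
move=> /nonunit_nilpotent[n nE]; apply: linear_inj => x /=.
move/eqP; rewrite subr_eq0 => /eqP xe; rewrite -(nE x).
by elim: n {nE} => //= n <-.
Qed.

(** If e + f had an inverse u, then uf = 1 - ue would be injective by [nonunit_sub]. *)
Lemma nonunit_add e f : ~ injective e -> ~ injective f ->
  ~ injective (e \+ f : {linear Y -> Y}).
Proof.
move=> ne nf ief; have [u [uK Ku]] := linear_inv ief (surj_of_inj ief).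
have nue : ~ injective (u \o e : {linear _ -> _}).
  by move=> i; apply: ne => x y xy; apply: i; rewrite /= xy.
apply: nf => x y xy; apply: (nonunit_sub nue) => /=.
have E z : z - u (e z) = u (f z).
  by apply/eqP; rewrite subr_eq addrC -linearD; apply/eqP/esym/uK.
by rewrite !E xy.
Qed.

Lemma nonunit_compl e f : ~ injective e -> ~ injective (e \o f : {linear _ -> _}).
Proof.
move=> ne i; apply: ne; apply: inj_of_surj => // y.
by have [x <-] := surj_of_inj i y; exists (f x).
Qed.

Lemma nonunit_sum n (e : 'I_n -> {linear Y -> Y}) :
  (forall i, ~ injective (e i)) ->
  exists f : {linear Y -> Y}, (forall x, f x = \sum_i e i x) /\ ~ injective f.
Proof.
elim: n e => [|n IH] e ne.
  exists \0; split=> [x|inj]; first by rewrite big_ord0.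
  by case: ind => + _; apply=> x; apply: inj.
have [f [fE nf]] := IH (fun i => e (lift ord0 i)) (fun i => ne _).
exists (e ord0 \+ f : {linear _ -> _}); split; last exact: nonunit_add.
by move=> x; rewrite big_ord_recl /= fE.
Qed.

Variable N0 : Y -> Prop.
Hypotheses (N00 : N0 0) (N0D : forall x y, N0 x -> N0 y -> N0 (x + y)).
Hypothesis N0e : forall e x, N0 x -> N0 (e x).

(** The End(Y)-submodule generated by [N0] and [s]. *)
Fixpoint end_span (s : seq Y) (x : Y) : Prop :=
  if s is y :: s' then
    exists (a : {linear Y -> Y}) (r : Y), end_span s' r /\ x = a y + r
  else N0 x.

Lemma end_spanD s x y : end_span s x -> end_span s y -> end_span s (x + y).
Proof.
elim: s x y => [|z s IH] x y /=; first exact: N0D.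
move=> [a [r [hr ->]]] [b [t [ht ->]]].
exists (a \+ b : {linear _ -> _}), (r + t); split; first exact: IH.
by rewrite /= addrACA.
Qed.

Lemma end_spanM s e x : end_span s x -> end_span s (e x).
Proof.
elim: s x => [|z s IH] x /=; first exact: N0e.
move=> [a [r [hr ->]]]; exists (e \o a : {linear _ -> _}), (e r).
by split; [exact: IH | rewrite linearD].
Qed.

Lemma end_span_base s x : N0 x -> end_span s x.
Proof.
elim: s x => //= z s IH x Nx; exists \0, x; split; first exact: IH.
by rewrite add0r.
Qed.

Lemma end_span_sum s (I : Type) (r : seq I) (F : I -> Y) :
  (forall i, end_span s (F i)) -> end_span s (\sum_(i <- r) F i).
Proof.
move=> h; elim/big_ind: _ => //; first exact: end_span_base.
exact: end_spanD.
Qed.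

(* Nakayama's lemma for Y / N0 over the local ring End(Y). *)
Lemma nakayama :
  (forall y, exists n (e : 'I_n -> {linear Y -> Y}) (z : 'I_n -> Y),
     (forall i, ~ injective (e i)) /\ N0 (y - \sum_i e i (z i))) ->
  forall x, N0 x.
Proof.
move=> h.
have red s : (forall x, end_span s x) -> forall x, N0 x.
  elim: s => [|y s IH] sp //; apply: IH => x.
  suff ys : end_span s y.
    have [a [r [hr ->]]] := sp x; apply: end_spanD => //; exact: end_spanM.
  have [n [e [z [ne yz]]]] := h y.
  have /choice[a /choice[r hr]] (i : 'I_n) := sp (z i).
  (* Substituting z_i = a_i(y) + r_i shows that y - f(y) lies in the span of the other generators.
     As [f] is a non-unit, 1 - f is invertible and [y] is redundant. *)
  have [f [fE nf]] := nonunit_sum (fun i => nonunit_compl (f := a i) (ne i)).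
  have fi := nonunit_sub nf.
  have [u [uK Ku]] := linear_inv fi (surj_of_inj fi).
  rewrite -(uK y); apply: end_spanM => /=.
  have -> : y - f y = (y - \sum_i e i (z i)) + \sum_i e i (r i).
    have -> : \sum_i e i (z i) = f y + \sum_i e i (r i).
      rewrite fE -big_split; apply: eq_bigr => i _ /=.
      by rewrite -linearD; have [_ <-] := hr i.
    by rewrite opprD addrA subrK.
  apply: end_spanD; first exact: end_span_base.
  by apply: end_span_sum => i; apply: end_spanM; have [] := hr i.
have [s sP] := fg_kspan Y; apply: (red s) => x; have [c ->] := sP x.
elim: s c {sP x} => [|y s IH] c; first by rewrite /kcomb big_ord0.
rewrite kcomb_cons.
have lf : linear (fun x : Y => fdscal L (c 0%N) *: x).
  by move=> a x z; rewrite scalerDr fdscalZ.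
by have [f fE] := linear_pack lf; exists f, (kcomb s (c \o S)); split; rewrite ?fE.
Qed.

End NonUnits.

Lemma direct_sum_proj (J : finType) (Y : J -> fgmod L) M : direct_sum Y M ->
  exists (h : forall i, {linear Y i -> M}) (r : forall i, {linear M -> Y i}),
    [/\ forall x, x = \sum_i h i (r i x), forall i y, r i (h i y) = y
      & forall i j y, i != j -> r i (h j y) = 0].
Proof.
move=> [h hE].
have /choice[y yE] x := hE x.
have yU x z : x = \sum_i h i (z i) -> y x = z by apply: (yE x).2.
have lr i : linear (fun x => y x i).
  move=> a u v; rewrite (yU _ (fun i => a *: y u i + y v i)) //.
  rewrite {1}(yE u).1 {1}(yE v).1 scaler_sumr -big_split.
  by apply: eq_bigr => l _; rewrite linearP.
pose r i := projT1 (cid (linear_pack (lr i))).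
have rE i x : r i x = y x i by rewrite /r; case: cid => g /= ->.
have yh j z : y (h j z) = dfwith (fun i => 0 : Y i) z.
  apply: yU; rewrite (bigD1 j) //= dfwith_in big1 ?addr0 // => i ij.
  by rewrite dfwith_out ?linear0 // eq_sym.
exists h, r; split=> [x|i z|i j z ij].
- by rewrite {1}(yE x).1; apply: eq_bigr => i _; rewrite rE.
- by rewrite rE yh dfwith_in.
- by rewrite rE yh dfwith_out // eq_sym.
Qed.

Lemma sum_compl (n : nat) (j : 'I_n) (V : zmodType) (F : 'I_n -> V) :
  \sum_(i : {i | i != j}) F (val i) = \sum_(i | i != j) F i.
Proof. by rewrite -(big_sub (fun i => i != j)). Qed.

Section SplitProjective.
Variables (W : subcat L) (wW : wide W) (M : fgmod L) (WM : W M).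
Variables (n : nat) (Y : 'I_n -> fgmod L).
Hypothesis dM : direct_sum Y M.
Hypothesis indY : forall i, indecomposable (Y i).
Hypothesis gm : forall j S, direct_sum (fun i : {i | i != j} => Y (val i)) S ->
  ~ Gen1 W S (Y j).

(** The summand is the kernel of the complementary idempotent of [M]. *)
Lemma summand_in j : W (Y j).
Proof.
have [h [r [hr rh rh0]]] := direct_sum_proj dM.
apply: (@wide_ker _ _ _ wW _ M M (h j) (idfun \- (h j \o r j))%R) => //.
split; first by move=> x y hxy; rewrite -(rh j x) hxy rh.
move=> y; split=> [/eqP|[x <-]] /=; last by rewrite rh subrr.
by rewrite subr_eq0 => /eqP ->; exists (r j y).
Qed.

(** If some composite from [Y j] through [M] and [E] back to [Y j] is invertible, it yields a
    section. Otherwise all are non-units, and Nakayama puts [Y j] in Gen of the complement, against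
    gen-minimality. *)
Lemma gen_minimal_split j E (p : {linear E -> Y j}) :
  Gen1 W M E -> surj p -> exists s : {linear Y j -> E}, forall y, p (s y) = y.
Proof.
move=> /Gen1P[WE tr] ps; have [h [r [hr rh rh0]]] := direct_sum_proj dM.
have [[f inj]|ninj] :=
    pselect (exists f : {linear M -> E}, injective (p \o (f \o h j) : {linear _ -> _})).
  have [u [_ Ku]] := linear_inv inj (surj_of_inj inj).
  by exists ((f \o h j) \o u : {linear _ -> _}) => y; apply: Ku.
(* The complement of [Y j] is realized as the kernel of its projection. *)
exfalso; have [S [iS [iSi iSE]]] := ker_fg (r j).
have dS : direct_sum (fun i : {i | i != j} => Y (val i)) S.
  have /= ex (i : {i | i != j}) : exists h' : {linear Y (val i) -> S},
      forall y, iS (h' y) = h (val i) y.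
    by apply: linear_lift => // y; apply/iSE; apply: rh0; rewrite eq_sym (valP i).
  pose h' i := projT1 (cid (ex i)).
  have h'E i y : iS (h' i y) = h (val i) y by rewrite /h'; case: cid.
  exists h' => x; exists (fun i => r (val i) (iS x)); split.
    apply: iSi; rewrite linear_sum (eq_bigr _ (fun i _ => h'E i _)).
    rewrite (sum_compl j (fun i => h i (r i (iS x)))) [LHS]hr (bigD1 j) //=.
    by rewrite (_ : r j (iS x) = 0) ?linear0 ?add0r //; apply/iSE; exists x.
  move=> y xE; apply: functional_extensionality_dep => l.
  rewrite xE !linear_sum (bigD1 l) //= h'E rh big1 ?addr0 // => i il.
  by rewrite h'E rh0 // (inj_eq val_inj) eq_sym.
apply: (gm dS); apply/Gen1P; split; first exact: summand_in.
apply: (nakayama (indY j)).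
- exact: submod0 (trace_submod _ _).
- by move=> x y; apply: submodD; exact: trace_submod.
- by move=> e x; apply: trace_map.
(* In a trace expansion of a preimage of [y], the [Y j] components contribute values of non-units,
   and the rest lies in the trace of [S]. *)
move=> y; have [x <-] := ps y; have [l lE] := tr x.
pose F i := nth (\0 : {linear M -> E}, 0) l i.
exists (size l), (fun i => p \o ((F i).1 \o h j) : {linear _ -> _}),
  (fun i => r j (F i).2); split=> [i inj|].
  by apply: ninj; exists (F i).1.
rewrite lE (big_nth (\0 : {linear M -> E}, 0)) big_mkord linear_sum -sumrB.
apply: submod_sum; first exact: trace_submod.
move=> i; rewrite -/(F i) /= -linearB -linearB.
have /iSE[s sE] : r j ((F i).2 - h j (r j (F i).2)) = 0 by rewrite linearB rh subrr.
by rewrite -sE; apply: (trace_mem (p \o ((F i).1 \o iS) : {linear _ -> _})).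
Qed.

End SplitProjective.
End Local.

(** * Upper covers of Gen M *)

Section Generated.
Variables (k : fieldType) (L : fdalg k) (W : subcat L) (wW : wide W).

Definition tors_gen (C : subcat L) : subcat L := fun X =>
  forall V, torsion_class W V -> subcat_le C V -> V X.

Lemma tors_gen_tors C : subcat_le C W -> torsion_class W (tors_gen C).
Proof.
move=> CW.
have sW : subcat_le (tors_gen C) W by move=> X; apply=> //; exact: torsion_class_self.
split=> // [A E B i p sip hA hB V tV CV|X].
  by apply: (tors_ext tV sip); [apply: hA | apply: hB].
split=> [|GX V tV CV]; first exact: sub_Gen.
by case: (tV) => _ _ VG; apply/VG; apply: (Gen_sub _ GX) => Y; apply.
Qed.

End Generated.

Section Main.
Variables (k : fieldType) (L : fdalg k) (W : subcat L) (wW : wide W).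
Variables (M tauM : fgmod L) (P : tau_presentation W M tauM) (WM : W M).
Hypothesis rigid : hom_zero M tauM.
Implicit Types (X Z K I E B Q S : fgmod L).

Let T : subcat L := Gen1 W M.
Let tT : torsion_class W T := Gen1_tors wW P rigid.

(** * A minimal object of a cover of Gen M *)

Section Cover.
Variables (n : nat) (Y : 'I_n -> fgmod L).
Hypothesis dM : direct_sum Y M.
Hypothesis indY : forall i, indecomposable (Y i).
Hypothesis gm : forall j S, direct_sum (fun i : {i | i != j} => Y (val i)) S ->
  ~ Gen1 W S (Y j).

Variables (U : subcat L) (cU : covers W T U).
Let tU : torsion_class W U. Proof. by case: cU. Qed.
Let TU : subcat_le T U. Proof. by case: cU. Qed.

Variable B : fgmod L.
Hypotheses (UB : U B) (nTB : ~ T B).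
Hypothesis small : forall X, U X -> (dim X < dim B)%N -> T X.
Hypothesis freeB : forall Z, T Z -> hom_zero Z B.
Let WB : W B. Proof. exact: tors_in UB. Qed.

Lemma surj_to_min X (u : {linear X -> B}) x : U X -> u x <> 0 -> surj u.
Proof.
move=> UX ux; have WX := tors_in tU UX.
have [I [q [j [WI qs ji uE]]]] := wide_im wW u WX WB.
have UI : U I by apply: (tors_quot tU UX WI qs).
suff js : surj j.
  by move=> b; have [y <-] := js b; have [z <-] := qs y; exists z.
move=> b; apply: contrapT => /forallNP nb.
have TI := small UI (dim_inj_lt ji nb).
by apply: ux; rewrite uE (freeB TI).
Qed.

(** The objects of [U] without nonzero maps to [B] form a class between [T] and [U] that omits [B],
    hence equal to [T]. So if [E] is outside [T] it maps nontrivially to [B]; the restriction to [B]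
    is nonzero, hence bijective, and splits the sequence. *)
Lemma ext_dichotomy E Z (i : {linear B -> E}) (p : {linear E -> Z}) :
  short_exact i p -> T Z -> T E \/ exists s : {linear Z -> E}, forall z, p (s z) = z.
Proof.
move=> sip TZ; case: (sip) => ii ex ps.
have UE : U E by apply: (tors_ext tU sip UB); apply: TU.
have [TE|nTE] := pselect (T E); [by left | right].
have [u [x ux]] : exists (u : {linear E -> B}) (x : E), u x <> 0.
  apply: contrapT => h; case: cU => _ _ nTU /(_ _ (tors_perp tU B)).
  case=> [X TX|X []||] //; first by split; [exact: TU | exact: freeB].
    move=> eqT; apply: nTE; apply/eqT; split=> // f y.
    by apply: contrapT => fy; apply: h; exists f, y.
  move=> eqU; apply: nTB; apply: (tors_zero tT) => // b.
  by have [_ hB] := (eqU B).2 UB; apply: (hB idfun).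
have [b uib] : exists b, u (i b) <> 0.
  apply: contrapT => /forallNP h; apply: ux.
  have [f fE] : exists f : {linear Z -> B}, forall e, f (p e) = u e.
    by apply: linear_desc => // y /ex[b <-]; apply: contrapT; apply: h.
  by rewrite -fE (freeB TZ).
have vs : surj (u \o i : {linear _ -> _}) by apply: (surj_to_min (x := b)).
have [w [wK Kw]] := linear_inv (inj_of_surj vs (leqnn _)) vs.
have [s sE] : exists s : {linear Z -> E}, forall e, s (p e) = e - i (w (u e)).
  apply: (linear_desc (f := (idfun \- (i \o (w \o u)))%R : {linear _ -> _})) => //.
  by move=> y /ex[z <-] /=; have /= -> := wK z; rewrite subrr.
exists s => z; have [e <-] := ps z; rewrite sE linearB.
by rewrite (_ : p (i _) = 0) ?subr0 //; apply/ex; exists (w (u e)).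
Qed.

Lemma ext_split E (i : {linear B -> E}) (p : {linear E -> M}) :
  short_exact i p -> exists s : {linear M -> E}, forall x, p (s x) = x.
Proof.
case=> ii ex ps; have [h [r [hr rh rh0]]] := direct_sum_proj dM.
have /= sj j : exists s : {linear Y j -> E}, forall y, p (s y) = h j y.
  have hi : injective (h j) by move=> x y hxy; rewrite -(rh j x) hxy rh.
  (* [E'] is the pullback of the extension along the inclusion of [Y j]; the sections over the
     summands are then added up. *)
  have [E' [e [ei eE]]] := sub_fg (submod_preim p (submod_im (h j))).
  have [i' i'E] : exists i' : {linear B -> E'}, forall b, e (i' b) = i b.
    apply: linear_lift => // b; apply/eE; exists 0.
    by rewrite linear0; apply/esym/ex; exists b.
  have [p' p'E] : exists p' : {linear E' -> Y j}, forall x, h j (p' x) = p (e x).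
    by apply: (linear_lift (f := p \o e : {linear _ -> _})) => // x; apply/eE; exists x.
  have sip' : short_exact i' p'.
    split.
    - by move=> a b ab; apply: ii; rewrite -!i'E ab.
    - move=> x; split=> [px|[b <-]].
        have /ex[b bE] : p (e x) = 0 by rewrite -p'E px linear0.
        by exists b; apply: ei; rewrite i'E.
      by apply: hi; rewrite p'E i'E linear0; apply/ex; exists b.
    - move=> y; have [x xE] := ps (h j y).
      have /eE[z zE] : exists y, h j y = p x by exists y.
      by exists z; apply: hi; rewrite p'E zE.
  have TY : T (Y j).
    apply: (Gen1_quot (p := r j)) (Gen1_self WM) _ _; first exact: (summand_in wW WM dM).
    by move=> y; exists (h j y).
  have [s sE] : exists s : {linear Y j -> E'}, forall y, p' (s y) = y.
    have [TE'|//] := ext_dichotomy sip' TY.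
    by apply: (gen_minimal_split wW WM dM indY gm TE'); case: sip'.
  by exists (e \o s : {linear _ -> _}) => y /=; rewrite -p'E sE.
pose s j := projT1 (cid (sj j)).
have sE j y : p (s j y) = h j y by rewrite /s; case: cid.
have ls : linear (fun x => \sum_j s j (r j x)).
  move=> a x y; rewrite scaler_sumr -big_split; apply: eq_bigr => j _ /=.
  by rewrite !linearP.
have [f fE] := linear_pack ls; exists f => x.
by rewrite fE linear_sum (eq_bigr _ (fun j _ => sE j _)) -hr.
Qed.

Lemma min_perp : hom_zero B tauM.
Proof.
have pe := @pmap_exact _ _ _ _ P.
have WP1 := pres1_in P; have WP0 := pres0_in P.
apply/(pres_hom_tau P WB) => g; have [K [iK kK]] := ker_fg (pmap1 P).
have WK : W K by apply: (wide_ker wW kK).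
case: (kK) => iKi iKE.
have [g0|/existsNP[x0 gx0]] := pselect (forall x, g (iK x) = 0).
  (* If [g] kills the kernel of [pmap1], the pushout of [g] and [pmap1], the cokernel of [D], is an
     extension of [M] by [B]. Its splitting extends [g] to P0. *)
  have lD : linear (fun x => (g x, - pmap1 P x) : prodmod B (pres0 P)).
    by move=> a x y; congr (_, _); rewrite /= linearP // opprD -scalerN.
  have [D DE] := linear_pack lD.
  have [E [q [qs qE]]] := quot_fg (submod_im D).
  have li : linear (fun b => q ((b, 0) : prodmod B (pres0 P))).
    by move=> a x y; rewrite -linearP; congr (q (_, _)); rewrite /= scaler0 addr0.
  have lj : linear (fun y => q ((0, y) : prodmod B (pres0 P))).
    by move=> a x y; rewrite -linearP; congr (q (_, _)); rewrite /= scaler0 addr0.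
  have [i iE] := linear_pack li; have [j jE] := linear_pack lj.
  have qij b y : q (b, y) = i b + j y.
    by rewrite iE jE -linearD; congr (q (_, _)); rewrite /= ?addr0 ?add0r.
  have lp : linear (fun z : prodmod B (pres0 P) => pmap0 P z.2).
    by move=> a x y; rewrite -linearP.
  have [p0' p0'E] := linear_pack lp.
  have [p pE] : exists p : {linear E -> M}, forall z, p (q z) = p0' z.
    apply: linear_desc => // z /qE[x <-]; rewrite p0'E DE /= linearN.
    by apply/eqP; rewrite oppr_eq0; apply/eqP/pe; exists x.
  have sip : short_exact i p.
    split.
    - apply: linear_inj => b; rewrite iE => /qE[x].
      rewrite DE => -[<- /eqP]; rewrite oppr_eq0 => /eqP/iKE[y <-].
      exact: g0.
    - move=> e; split=> [|[b <-]]; last by rewrite iE pE p0'E /= linear0.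
      have [[b y] <-] := qs e; rewrite pE p0'E /= => /pe[x xE].
      exists (b + g x); have : q (D x) = 0 by apply/qE; exists x.
      rewrite DE qij xE linearN => /eqP; rewrite subr_eq0 => /eqP.
      by rewrite linearD qij => ->.
    - move=> m; have [y <-] := pmap0_surj P m; exists (q (0, y)).
      by rewrite pE p0'E.
  have [s sE] := ext_split sip; case: (sip) => ii ex _.
  have [r rE] : exists r : {linear E -> B}, forall e, i (r e) = e - s (p e).
    apply: (linear_lift (f := (idfun \- (s \o p))%R : {linear _ -> _})) => // e /=.
    by apply/ex; rewrite linearB sE subrr.
  exists (r \o j : {linear _ -> _}) => x /=.
  have -> : j (pmap1 P x) = i (g x).
    have : q (D x) = 0 by apply/qE; exists x.
    by rewrite DE qij linearN => /eqP; rewrite subr_eq0 => /eqP.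
  have pig : p (i (g x)) = 0 by apply/ex; exists (g x).
  by apply: ii; rewrite rE pig linear0 subr0.
(* Otherwise B/g(K) is a proper quotient, so it lies in [T], and [g] factors through [pmap1] modulo
   g(K). *)
have [Q [c cQ]] := coker_fg (g \o iK : {linear _ -> _}).
have WQ : W Q by apply: (wide_coker wW cQ).
case: cQ => cE cs.
have UQ : U Q by apply: (tors_quot tU UB WQ cs).
have TQ : T Q.
  by apply: small => //; apply: (dim_surj_lt cs _ gx0); apply/cE; exists x0.
have hQ := Gen1_perp rigid TQ.
have [h0 h0E] := (pres_hom_tau P WQ).1 hQ (c \o g : {linear _ -> _}).
have [h hE] := pres0_proj (t := P) h0 WB WQ cs.
exists h; pose g' : {linear pres1 P -> B} := (g \- (h \o pmap1 P))%R.
have [G [iG kG]] := ker_fg g'.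
have WG : W G by apply: (wide_ker wW kG).
case: kG => _ iGE.
(* The error [g'] takes values in g(K) and agrees with [g] on [K], so its kernel [G] and [K]
   together span P1; minimality of the presentation gives g' = 0. *)
suff /(pmap1_superfluous WG) Gs : forall x, exists z, pmap1 P (iG z) = pmap1 P x.
  move=> x; have [z <-] := Gs x; apply/eqP; rewrite -subr_eq0; apply/eqP.
  by apply/(iGE (iG z)); exists z.
move=> x; have /cE[y /= yE] : c (g' x) = 0.
  by rewrite /= linearB hE -h0E subrr.
have pK : pmap1 P (iK y) = 0 by apply/iKE; exists y.
have /iGE[z zE] : g' (x - iK y) = 0.
  by rewrite linearB /= pK linear0 subr0 -yE subrr.
by exists z; rewrite zE linearB pK subr0.
Qed.

End Cover.

Lemma cover_perp (U : subcat L) : gen_minimal W M -> covers W T U ->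
  forall X, U X -> hom_zero X tauM.
Proof.
move=> [n [Y [dM indY gm]]] cU; case: (cU) => tU TU nTU minU.
have [|B [UB nTB small freeB]] := minimal_outside wW tT tU.
  by move=> UT; apply: nTU => X; split; [apply: TU | apply: UT].
have hB := min_perp dM indY gm cU UB nTB small freeB.
case: (minU _ (tors_perp tU tauM)) => [X TX|X []//|eqT|eqU X UX].
- by split; [exact: TU | exact: (Gen1_perp rigid TX)].
- by case: nTB; apply/eqT.
- by have [] := (eqU X).2 UX.
Qed.

Lemma perp_below_pop (G : subcat L) : torsion_class W G -> subcat_le T G ->
  (forall U, covers W T U -> subcat_le U G) ->
  forall X, W X -> hom_zero X tauM -> G X.
Proof.
move=> tG TG cG; suff h : subcat_le (fun X => W X /\ hom_zero X tauM) G.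
  by move=> X WX hX; apply: h.
apply: contrapT => nG.
have [B [[WB hB] nGB smallB freeB]] := minimal_outside wW tG (perp_tors wW tauM) nG.
(* The candidate cover is the join of [T] and [B], given by generators so that a containment needs
   checking only on [T] and on [B]. *)
pose C X := T X \/ X = B.
have CW : subcat_le C W by move=> X [[]|->].
have tU := tors_gen_tors wW CW; set U := tors_gen W C in tU.
have TU : subcat_le T U by move=> X TX V tV; apply; left.
have UB : U B by move=> V tV; apply; right.
have TM : T M by apply: Gen1_self.
apply: (nGB); apply: (cG U) => //; split=> // [eqT|V tV TV VU].
  by apply: nGB; apply: TG; apply/eqT.
have [VT|nVT] := pselect (subcat_le V T).
  by left=> X; split; [exact: VT | exact: TV].
right=> X; split; first exact: VU.
suff VB : V B by apply=> // Z [|->]; first exact: TV.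
have [N [VN nTN smallN freeN]] := minimal_outside wW tT tV nVT.
have WN := tors_in tV VN.
have hN : hom_zero N tauM.
  have [] // : W N /\ hom_zero N tauM.
  apply: (VU N VN _ (perp_tors wW tauM)) => Z [TZ|->//].
  by split; [exact: (tors_in tT TZ) | exact: (Gen1_perp rigid TZ)].
(* Otherwise [T] and [B] both lie in the left perpendicular class of [N], hence so does [N], which
   would be zero. *)
have [f [x0 fx0]] : exists (f : {linear B -> N}) (x : B), f x <> 0.
  apply: contrapT => h; apply: nTN; apply: (tors_zero tT) => // y.
  have [|_ hNN] := VU N VN _ (perp_tors wW N); last exact: (hNN idfun).
  move=> Z [TZ|->]; split=> //; [exact: (tors_in tT TZ) | exact: freeN |].
  by move=> f x; apply: contrapT => fx; apply: h; exists f, x.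
have fs : surj f.
  have [I [q [j [WI qs ji fE]]]] := wide_im wW f WB WN.
  have [Q [c cj]] := coker_fg j; have WQ : W Q by apply: (wide_coker wW cj).
  case: cj => cE cs.
  (* The cokernel is generated by [M], yet every map from [M] to it lifts to [N], where it
     vanishes. *)
  have TQ : T Q.
    apply: smallN; first exact: (tors_quot tV VN WQ cs).
    by apply: (dim_surj_lt cs _ fx0); apply/cE; exists (q x0).
  have [_ hI] := tors_quot (perp_tors wW tauM) (conj WB hB) WI qs.
  have hMQ : hom_zero M Q.
    move=> g x; have [g' <-] := lift_perp wW P g (And3 ji cE cs) WN WQ hI.
    by rewrite (freeN M TM) linear0.
  move=> y; have /cE[z <-] : c y = 0.
    by case/Gen1P: TQ => _ /(_ (c y))[l ->]; rewrite big1 // => u _; apply: hMQ.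
  by have [x <-] := qs z; exists x.
have [K [i kf]] := ker_fg f; have WK : W K by apply: (wide_ker wW kf).
have hK := ker_perp wW P kf WB WN hB (freeN M TM).
case: kf => ii iE.
have [i0|/existsNP[z iz]] := pselect (forall x, i x = 0).
  have fi : injective f by apply: linear_inj => x /iE[y <-].
  have [g [gK Kg]] := linear_inv fi fs; apply: (tors_quot tV VN WB (p := g)).
  by move=> x; exists (f x).
(* If the kernel is nonzero, both it and [N] are smaller than [B] and perpendicular to [tauM], so
   they lie in [G], and so does their extension [B]. *)
exfalso; apply: nGB; apply: (tors_ext tG (And3 ii iE fs)).
  apply: smallB => //; apply: (dim_inj_lt ii (y := x0)) => x xE.
  by apply: fx0; apply/iE; exists x.
by apply: smallB => //; apply: (dim_surj_lt fs _ iz); apply/iE; exists z.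
Qed.

End Main.

Theorem proposition8p4 (k : fieldType) (L : fdalg k) (W : subcat L)
    (M tauM : fgmod L) :
  basic_algebra L ->
  wide W -> functorially_finite W ->
  W M -> is_tau_in W M tauM ->
  basic M -> hom_zero M tauM ->
  gen_minimal W M ->
  subcat_eq (pop_up W (Gen1 W M)) (fun X => W X /\ hom_zero X tauM).
Proof.
move=> _ wW _ WM tauMW _ rigid gm X; have [P] := tau_in_pres wW tauMW.
split=> [pX|[WX hX] G tG FG].
  apply: (pX _ (perp_tors wW tauM)) => U [->|cU] Z ZT.
    by split; [case: ZT | exact: (Gen1_perp rigid ZT)].
  split; last exact: (cover_perp wW P WM rigid gm cU ZT).
  by case: cU => -[UW _ _] _ _ _; apply: UW.
apply: (perp_below_pop wW P WM rigid tG) => // [|U cU]; last by apply: FG; right.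
by apply: FG; left.
Qed.
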